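(* Let $(\mathfrak{A},\mathsf{L}_{\mathfrak{A}})$ and $(\mathfrak{B},\mathsf{L}_{\mathfrak{B}})$ be Leibniz quantum compact metric spaces, $\gamma=(\mathfrak{D},\omega,\pi_{\mathfrak{A}},\pi_{\mathfrak{B}})$ a bridge from $\mathfrak{A}$ to $\mathfrak{B}$ with length $\lambda=\lambda(\gamma\mid\mathsf{L}_{\mathfrak{A}},\mathsf{L}_{\mathfrak{B}})$, and $\varepsilon\ge0$ with $\lambda+\varepsilon>0$. Define for $(a,b)\in\mathfrak{sa}(\mathfrak{A}\oplus\mathfrak{B})$: $$\mathsf{L}_\varepsilon(a,b)=\max\left\{\mathsf{L}_{\mathfrak{A}}(a),\ \mathsf{L}_{\mathfrak{B}}(b),\ \frac{1}{\lambda+\varepsilon}\|\pi_{\mathfrak{A}}(a)\omega-\omega\pi_{\mathfrak{B}}(b)\|_{\mathfrak{D}}\right\}.$$ Then $\mathsf{L}_\varepsilon$ is a Lip-norm on $\mathfrak{A}\oplus\mathfrak{B}$ which is admissible for $(\mathsf{L}_{\mathfrak{A}},\mathsf{L}_{\mathfrak{B}})$ and satisfies the Leibniz inequalities (for the Jordan product $\frac{xy+yx}{2}$ and the Lie product $\frac{xy-yx}{2i}$ on $\mathfrak{sa}(\mathfrak{A}\oplus\mathfrak{B})$), and, identifying $\mathscr{S}(\mathfrak{A})$ and $\mathscr{S}(\mathfrak{B})$ with their canonical images in $\mathscr{S}(\mathfrak{A}\oplus\mathfrak{B})$, $$\mathrm{Haus}_{\mathrm{mk}_{\mathsf{L}_\varepsilon}}(\mathscr{S}(\mathfrak{A}),\mathscr{S}(\mathfrak{B}))\le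 2\lambda+\varepsilon.$$ Consequently $\mathrm{dist}_q((\mathfrak{A},\mathsf{L}_{\mathfrak{A}}),(\mathfrak{B},\mathsf{L}_{\mathfrak{B}}))\le 2\lambda$.
   Context: Notation: $\mathfrak{sa}(\mathfrak{A})$ self-adjoint part, $\mathscr{S}(\mathfrak{A})$ state space; $\mathrm{Haus}_d$ is the Hausdorff distance for the metric $d$. Quantum compact metric space $(\mathfrak{A},\mathsf{L})$: unital C*-algebra with a seminorm $\mathsf{L}$ (a Lip-norm) on a dense subspace $\mathrm{dom}(\mathsf{L})\subseteq\mathfrak{sa}(\mathfrak{A})$ ($\mathsf{L}=\infty$ elsewhere), vanishing exactly on $\mathbb{R}1_{\mathfrak{A}}$, such that $\mathrm{mk}_{\mathsf{L}}(\varphi,\psi)=\sup\{|\varphi(a)-\psi(a)|:a\in\mathfrak{sa}(\mathfrak{A}),\mathsf{L}(a)\le1\}$ metrizes the weak* topology on $\mathscr{S}(\mathfrak{A})$. A Leibniz quantum compact metric space is a quantum compact metric space with $\mathsf{L}$ lower semi-continuous for the norm and, for all $a,b\in\mathfrak{sa}(\mathfrak{A})$, $\mathsf{L}(\frac{ab+ba}{2})\le\|a\|\mathsf{L}(b)+\|b\|\mathsf{L}(a)$ and $\mathsf{L}(\frac{ab-ba}{2i})\le\|a\|\mathsf{L}(b)+\|b\|\mathsf{L}(a)$. $\mathrm{Lip}_1(\mathfrak{A},\mathsf{L})=\{a\in\mathfrak{sa}(\mathfrak{A}):\mathsf{L}(a)\le1\}$. $1$-level: $\mathscr{S}_1(\omega)=\{\varphi\in\mathscr{S}(\mathfrak{D}):\varphi((1-\omega)^*(1-\omega))=0=\varphi((1-\omega)(1-\omega)^*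 )\}$. Bridge from $\mathfrak{A}$ to $\mathfrak{B}$: $\gamma=(\mathfrak{D},\omega,\pi_{\mathfrak{A}},\pi_{\mathfrak{B}})$ with $\mathfrak{D}$ a unital C*-algebra, $\omega\in\mathfrak{D}$ with $\mathscr{S}_1(\omega)\ne\emptyset$, $\pi_{\mathfrak{A}},\pi_{\mathfrak{B}}$ unital injective *-homomorphisms into $\mathfrak{D}$. Reach: norm-Hausdorff distance in $\mathfrak{D}$ between $\pi_{\mathfrak{A}}(\mathrm{Lip}_1(\mathfrak{A},\mathsf{L}_{\mathfrak{A}}))\omega$ and $\omega\pi_{\mathfrak{B}}(\mathrm{Lip}_1(\mathfrak{B},\mathsf{L}_{\mathfrak{B}}))$. Height: $\max\{\mathrm{Haus}_{\mathrm{mk}_{\mathsf{L}_{\mathfrak{A}}}}(\mathscr{S}(\mathfrak{A}),\{\varphi\circ\pi_{\mathfrak{A}}:\varphi\in\mathscr{S}_1(\omega)\}),\mathrm{Haus}_{\mathrm{mk}_{\mathsf{L}_{\mathfrak{B}}}}(\mathscr{S}(\mathfrak{B}),\{\varphi\circ\pi_{\mathfrak{B}}:\varphi\in\mathscr{S}_1(\omega)\})\}$. Length $\lambda(\gamma\mid\mathsf{L}_{\mathfrak{A}},\mathsf{L}_{\mathfrak{B}})$: maximum of reach and height. A Lip-norm $\mathsf{L}$ on $\mathfrak{A}\oplus\mathfrak{B}$ (i.e. $(\mathfrak{A}\oplus\mathfrak{B},\mathsf{L})$ is a quantum compact metric space) is admissible for $(\mathsf{L}_{\mathfrak{A}},\mathsf{L}_{\mathfrak{B}})$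 if $\mathsf{L}_{\mathfrak{A}}(a)=\inf\{\mathsf{L}(a,b):b\in\mathfrak{sa}(\mathfrak{B})\}$ for all $a\in\mathfrak{sa}(\mathfrak{A})$ and $\mathsf{L}_{\mathfrak{B}}(b)=\inf\{\mathsf{L}(a,b):a\in\mathfrak{sa}(\mathfrak{A})\}$ for all $b\in\mathfrak{sa}(\mathfrak{B})$. Rieffel's quantum Gromov-Hausdorff distance $\mathrm{dist}_q$ is the infimum, over all admissible Lip-norms $\mathsf{L}$, of $\mathrm{Haus}_{\mathrm{mk}_{\mathsf{L}}}(\mathscr{S}(\mathfrak{A}),\mathscr{S}(\mathfrak{B}))$, where $\mathscr{S}(\mathfrak{A})$, $\mathscr{S}(\mathfrak{B})$ are identified with states of $\mathfrak{A}\oplus\mathfrak{B}$ via $\varphi\mapsto((a,b)\mapsto\varphi(a))$ and $\psi\mapsto((a,b)\mapsto\psi(b))$. *)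

(* Defs.v *)
From HB Require Import structures.
From mathcomp Require Import all_boot all_order all_algebra.
From mathcomp Require Import complex.
From mathcomp Require Import boolp classical_sets reals constructive_ereal ereal.
Set Implicit Arguments. Unset Strict Implicit. Unset Printing Implicit Defensive.
Import Order.TTheory GRing.Theory Num.Theory.
Local Open Scope ring_scope.
Local Open Scope classical_set_scope.

Definition cabs (R : realType) (z : R[i]) : R := Normc.normc z.
Definition rC (R : realType) (r : R) : R[i] := Complex r 0.
Definition iC (R : realType) : R[i] := Complex 0 1.

Definition haus (R : realType) (T : Type) (d : T -> T -> \bar R) (X Y : set T)
  : \bar R :=
  maxe (ereal_sup [set ereal_inf [set d x y | y in Y] | x in X])
       (ereal_sup [set ereal_inf [set d x y | x in X] | y in Y]).

Section CStar.
Variable R : realType.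
Local Notation C := R[i].
Variable A : algType C.
Variable star : A -> A.
Variable nrm : A -> R.

(* unital C*-algebra: complete normed *-algebra over C with the C*-identity
   (unital: A is a (nontrivial) ring with unit 1) *)
Definition is_cstar : Prop :=
  [/\ ((forall x, 0 <= nrm x) /\ (forall x, nrm x = 0 -> x = 0)),
      ((forall x y, nrm (x + y) <= nrm x + nrm y) /\
       (forall (c : C) x, nrm (c *: x) = cabs c * nrm x) /\
       (forall x y, nrm (x * y) <= nrm x * nrm y)),
      [/\ (forall x, star (star x) = x),
          (forall x y, star (x + y) = star x + star y),
          (forall (c : C) x, star (c *: x) = conjc c *: star x) &
          (forall x y, star (x * y) = star y * star x)],
      (forall x, nrm (star x * x) = nrm x ^+ 2) &
      (forall u : nat -> A,
         (forall e : R, 0 < e -> exists N, forall m n, (N <= m)%N -> (N <= n)%N ->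
             nrm (u m - u n) < e) ->
         exists l, forall e : R, 0 < e -> exists N, forall n, (N <= n)%N ->
             nrm (u n - l) < e)].

Definition sa (x : A) : Prop := star x = x.

Definition is_state (phi : A -> C) : Prop :=
  [/\ (forall x y, phi (x + y) = phi x + phi y),
      (forall (c : C) x, phi (c *: x) = c * phi x),
      (forall x, 0 <= phi (star x * x)) & phi 1 = 1].

Definition states : set (A -> C) := [set phi | is_state phi].

Definition Lip1 (L : A -> \bar R) : set A := [set a | sa a /\ (L a <= 1)%E].

Definition mk (L : A -> \bar R) (phi psi : A -> C) : \bar R :=
  ereal_sup [set (cabs (phi a - psi a))%:E | a in Lip1 L].

(* mk_L is a metric whose topology on the state space is the weak* one *)
Definition mk_metrizes (L : A -> \bar R) : Prop :=
  [/\ (forall phi psi, is_state phi -> is_state psi -> (mk L phi psi < +oo)%E),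
      (forall phi, is_state phi -> forall e : R, 0 < e ->
         exists (s : seq A) (d : R), 0 < d /\
           forall psi, is_state psi ->
             (forall a, a \in s -> cabs (phi a - psi a) < d) ->
             (mk L phi psi < e%:E)%E) &
      (forall phi, is_state phi -> forall (a : A) (d : R), 0 < d ->
         exists e : R, 0 < e /\
           forall psi, is_state psi -> (mk L phi psi < e%:E)%E ->
             cabs (phi a - psi a) < d)].

Definition is_qcms (L : A -> \bar R) : Prop :=
  [/\ (forall a, (L a < +oo)%E -> sa a),
      ((forall a, (0 <= L a)%E) /\
       (forall (r : R) a, L (rC r *: a) = (`|r|%:E * L a)%E) /\
       (forall a b, (L (a + b)%R <= L a + L b)%E)),
      (forall a, sa a -> forall e : R, 0 < e ->
         exists b, (L b < +oo)%E /\ nrm (a - b) < e),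
      (forall a, L a = 0%E <-> exists r : R, a = rC r *: 1) &
      mk_metrizes L].

Definition lsc_norm (L : A -> \bar R) : Prop :=
  forall a (t : R), (t%:E < L a)%E ->
    exists d : R, 0 < d /\ forall b, nrm (a - b) < d -> (t%:E < L b)%E.

Definition leibniz_ineq (L : A -> \bar R) : Prop :=
  forall a b, sa a -> sa b ->
    (L ((2 : C)^-1 *: (a * b + b * a))%R <= (nrm a)%:E * L b + (nrm b)%:E * L a)%E /\
    (L ((2 * iC R)^-1 *: (a * b - b * a))%R <= (nrm a)%:E * L b + (nrm b)%:E * L a)%E.

Definition is_leibniz_qcms (L : A -> \bar R) : Prop :=
  [/\ is_qcms L, lsc_norm L & leibniz_ineq L].

End CStar.

Section Bridge.
Variable R : realType.
Local Notation C := R[i].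

Definition is_unital_star_monomorphism (A D : algType C)
  (sA : A -> A) (sD : D -> D) (f : A -> D) : Prop :=
  [/\ (forall x y, f (x + y) = f x + f y),
      (forall (c : C) x, f (c *: x) = c *: f x),
      ((forall x y, f (x * y) = f x * f y) /\ f 1 = 1),
      (forall x, f (sA x) = sD (f x)) &
      injective f].

Variables (A B D : algType C) (sA : A -> A) (sB : B -> B) (sD : D -> D).
Variables (nA : A -> R) (nB : B -> R) (nD : D -> R).

Definition level1 (omega : D) : set (D -> C) :=
  [set phi | [/\ is_state sD phi,
     phi (sD (1 - omega) * (1 - omega)) = 0 &
     phi ((1 - omega) * sD (1 - omega)) = 0]].

Definition is_bridge (omega : D) (piA : A -> D) (piB : B -> D) : Prop :=
  [/\ level1 omega !=set0,
      is_unital_star_monomorphism sA sD piA &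
      is_unital_star_monomorphism sB sD piB].

Variables (LA : A -> \bar R) (LB : B -> \bar R).

Definition bridge_reach (omega : D) (piA : A -> D) (piB : B -> D) : \bar R :=
  haus (fun x y => (nD (x - y))%:E)
    [set piA a * omega | a in Lip1 sA LA]
    [set omega * piB b | b in Lip1 sB LB].

Definition bridge_height (omega : D) (piA : A -> D) (piB : B -> D) : \bar R :=
  maxe (haus (mk sA LA) (states sA) [set phi \o piA | phi in level1 omega])
       (haus (mk sB LB) (states sB) [set phi \o piB | phi in level1 omega]).

Definition bridge_length (omega : D) (piA : A -> D) (piB : B -> D) : \bar R :=
  maxe (bridge_reach omega piA piB) (bridge_height omega piA piB).

Definition sum_star (x : (A * B)%type) : (A * B)%type := (sA x.1, sB x.2).
Definition sum_norm (x : (A * B)%type) : R := Num.max (nA x.1) (nB x.2).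

Definition stA (phi : A -> C) : (A * B)%type -> C := fun x => phi x.1.
Definition stB (psi : B -> C) : (A * B)%type -> C := fun x => psi x.2.

Definition admissible (L : (A * B)%type -> \bar R) : Prop :=
  [/\ is_qcms sum_star sum_norm L,
      (forall a, sa sA a -> LA a = ereal_inf [set L (a, b) | b in [set b | sa sB b]]) &
      (forall b, sa sB b -> LB b = ereal_inf [set L (a, b) | a in [set a | sa sA a]])].

Definition dist_q : \bar R :=
  ereal_inf [set haus (mk sum_star L) (stA @` states sA) (stB @` states sB)
            | L in [set L | admissible L]].

Definition bridge_lipnorm (omega : D) (piA : A -> D) (piB : B -> D) (lam eps : R)
  (x : (A * B)%type) : \bar R :=
  maxe (maxe (LA x.1) (LB x.2))
       (((lam + eps)^-1 * nD (piA x.1 * omega - omega * piB x.2))%:E).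

End Bridge.

(* Main.v *)
Require Import Defs.
From HB Require Import structures.
From mathcomp Require Import all_boot all_order all_algebra.
From mathcomp Require Import complex ring lra.
From mathcomp Require Import boolp classical_sets reals constructive_ereal ereal.
Set Implicit Arguments. Unset Strict Implicit. Unset Printing Implicit Defensive.
Import Order.TTheory GRing.Theory Num.Theory.
Local Open Scope ring_scope.
Local Open Scope classical_set_scope.

(* The element omega acts as 1 on each theta in its 1-level: theta (x omega) =
   theta (omega x) = theta x by Cauchy-Schwarz.  Hence theta o piA and theta o piB
   differ by at most the gap |piA a omega - omega piB b| on (a, b), and the height
   moves an arbitrary state to such a theta; the reach gives admissibility, and
   the gap is a twisted derivation, which gives the Leibniz inequalities.
   A state of the direct sum is a convex combination t phi + (1 - t) psi of
   states of the summands, so mk_L metrizes the weak* topology as soon as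
   phi a - psi b is uniformly bounded on the unit ball of L.  The C*-algebraic
   input (states and *-homomorphisms are contractive) comes from the existence
   of the square root of 1 - h for selfadjoint h with |h| < 1. *)

(** * The modulus and real scalars in the complex numbers *)

Section ComplexModulus.
Variable R : realType.
Implicit Types (z w : R[i]) (r : R).

Lemma cabs_ge0 z : 0 <= cabs z.
Proof. by case: z => a b; rewrite /cabs /= sqrtr_ge0. Qed.

Lemma cabs0 : cabs (0 : R[i]) = 0.
Proof. exact: Normc.normc0. Qed.

Lemma cabsM z w : cabs (z * w) = cabs z * cabs w.
Proof. exact: Normc.normcM. Qed.

Lemma cabsD z w : cabs (z + w) <= cabs z + cabs w.
Proof. exact: le_normcD. Qed.

Lemma cabsN z : cabs (- z) = cabs z.
Proof. exact: normcN. Qed.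

Lemma cabsB z w : cabs (z - w) <= cabs z + cabs w.
Proof. by rewrite -(cabsN w) cabsD. Qed.

Lemma cabs_distC z w : cabs (z - w) = cabs (w - z).
Proof. by rewrite -cabsN opprB. Qed.

Lemma cabs_dist_trans w z z' : cabs (z - z') <= cabs (z - w) + cabs (w - z').
Proof. by apply: le_trans (cabsD _ _); rewrite addrA subrK. Qed.

Lemma cabs_rC r : cabs (rC r) = `|r|.
Proof. by rewrite /cabs /rC /= expr0n /= addr0 sqrtr_sqr. Qed.

Lemma cabsZ r z : 0 <= r -> cabs (rC r * z) = r * cabs z.
Proof. by move=> r0; rewrite cabsM cabs_rC ger0_norm. Qed.

Lemma cabs_iC : cabs (iC R) = 1.
Proof. by rewrite /cabs /iC /= expr0n expr1n add0r sqrtr1. Qed.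

Lemma cabs_sqr z : cabs z ^+ 2 = complex.Re z ^+ 2 + complex.Im z ^+ 2.
Proof.
by case: z => a b; rewrite /cabs /= sqr_sqrtr // addr_ge0 // sqr_ge0.
Qed.

Lemma cabs_half : cabs (2^-1 : R[i]) = 2^-1.
Proof.
have -> : (2^-1 : R[i]) = rC 2^-1.
  by rewrite -[rC _]/((2^-1)%:C)%C fmorphV rmorphD rmorph1.
by rewrite cabs_rC ger0_norm // invr_ge0.
Qed.

Lemma ReB z w : complex.Re (z - w) = complex.Re z - complex.Re w.
Proof. by case: z; case: w. Qed.

Lemma Re_rCM r z : complex.Re (rC r * z) = r * complex.Re z.
Proof. by case: z => a b /=; rewrite mul0r subr0. Qed.

Lemma rCD r s : rC (r + s) = rC r + rC s.
Proof. by rewrite /rC -[0 in LHS]addr0. Qed.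

Lemma rCB r s : rC (r - s) = rC r - rC s.
Proof. by rewrite /rC -[0 in LHS]subr0. Qed.

Lemma rCM r s : rC (r * s) = rC r * rC s.
Proof. exact: (rmorphM (real_complex R)). Qed.

Lemma rC0 : rC 0 = 0 :> R[i].
Proof. by []. Qed.

Lemma rC1 : rC 1 = 1 :> R[i].
Proof. by []. Qed.

Lemma rCVK r : r != 0 -> rC r * rC r^-1 = 1.
Proof. by move=> r0; rewrite -rCM divff. Qed.

Lemma ge0_rC z : 0 <= z -> z = rC (complex.Re z).
Proof. by case: z => a b; rewrite lecE /= => /andP[/eqP -> _]. Qed.

Lemma rC_ge0 r : (0 <= rC r) = (0 <= r).
Proof. by rewrite lecE /= eqxx. Qed.

Lemma conjc_rC r : conjc (rC r) = rC r.
Proof. by rewrite /rC /= oppr0. Qed.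

End ComplexModulus.

(** * Geometric decay, approximation of infima, finite bounds *)

Section RealFacts.
Variable R : realType.

Lemma bernoulli (x : R) n : 0 <= x -> 1 + n%:R * x <= (1 + x) ^+ n.
Proof.
move=> x0; elim: n => [|n IHn]; first by rewrite mul0r addr0 expr0.
rewrite exprS -natr1.
have := ler_wpM2l (addr_ge0 ler01 x0) IHn.
have : 0 <= n%:R * x * x by rewrite !mulr_ge0.
nra.
Qed.

Lemma expr_lt_eps (q e : R) : 0 <= q -> q < 1 -> 0 < e ->
  exists N, forall n, (N <= n)%N -> q ^+ n < e.
Proof.
move=> q0 q1 e0.
have [->|qn0] := eqVneq q 0.
  by exists 1%N => -[//|n] _; rewrite expr0n.
have qp : 0 < q by rewrite lt_neqAle eq_sym qn0.
pose p := q^-1 - 1.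
have p0 : 0 < p by rewrite subr_gt0 invf_gt1.
(* Here [e^-1] is less than [N] times [p], so Bernoulli's inequality for [q^-1 = 1 + p] gives
   [e^-1 < q^-1 ^+ N]. *)
pose N := Num.bound (e^-1 / p).
have hN : e^-1 < 1 + N%:R * p.
  have := @archi_boundP R (e^-1 / p); rewrite ltr_pdivrMr // => h.
  by have := h (divr_ge0 (ltW _) (ltW p0)); rewrite invr_gt0 => /(_ e0); rewrite -/N; lra.
exists N => n Nn.
apply: (@le_lt_trans _ _ (q ^+ N)).
  by apply: ler_wiXn2l => //; exact: ltW.
rewrite -[q]invrK exprVn invf_plt ?posrE ?exprn_gt0 ?invr_gt0 //.
apply: lt_le_trans hN _.
have -> : q^-1 = 1 + p by rewrite /p; ring.
by apply: bernoulli; exact: ltW.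
Qed.

(** Shaped for admissibility: extending an element rescales it to the unit ball, which needs a bound
    [r] that is positive even if [m = 0], and yields a relative error [d]. *)
Lemma ereal_inf_approx (S : set (\bar R)) (m : \bar R) : (0 <= m)%E ->
  (forall y, S y -> (m <= y)%E) ->
  (forall r d : R, 0 < r -> (m <= r%:E)%E -> 0 < d ->
     exists2 y, S y & (y <= (r * (1 + d))%:E)%E) ->
  m = ereal_inf S.
Proof.
move=> m0 lb ub; apply/le_anti/andP; split; first exact/ereal_infP.
case: m m0 {lb} ub => [m| |] // m0 ub; last by rewrite leey.
rewrite lee_fin in m0; apply/lee_addgt0Pr => e e0.
(* With [r = m + e / 2] and [d = (e / 2) / r], the bound [r * (1 + d)] equals [m + e]. *)
have r0 : 0 < m + e / 2 by rewrite ltr_wpDl // divr_gt0.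
have d0 : 0 < e / 2 / (m + e / 2) by rewrite divr_gt0 // divr_gt0.
have mr : (m%:E <= (m + e / 2)%:E)%E by rewrite lee_fin; lra.
have [y Sy hy] := ub _ _ r0 mr d0.
apply: ge_ereal_inf; exists y => //; apply: le_trans hy _.
rewrite -EFinD lee_fin mulrDr mulr1 [X in _ + X <= _]mulrC divfK ?lt0r_neq0 //; lra.
Qed.

Lemma seq_bounded (T : eqType) (f : T -> R) (s : seq T) :
  exists M : R, 0 <= M /\ forall a, a \in s -> f a <= M.
Proof.
elim: s => [|a s [M [M0 HM]]]; first by exists 0.
exists (Num.max M (f a)); split; first by rewrite le_max M0.
move=> b; rewrite inE => /orP[/eqP ->|/HM hb]; rewrite le_max ?lexx ?orbT //.
by rewrite hb.
Qed.

End RealFacts.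

(** * C*-algebras: norm, involution, square roots *)

Section CStarTheory.
Variables (R : realType) (A : algType R[i]) (star : A -> A) (nrm : A -> R).
Hypothesis cA : is_cstar star nrm.

Lemma nrm_ge0 x : 0 <= nrm x. Proof. by case: cA => -[]. Qed.
Lemma nrm0_eq0 x : nrm x = 0 -> x = 0. Proof. by case: cA => -[_ h] _ _ _ _; exact: h. Qed.
Lemma nrmD x y : nrm (x + y) <= nrm x + nrm y.
Proof. by case: cA => _ []. Qed.
Lemma nrmZ c x : nrm (c *: x) = cabs c * nrm x.
Proof. by case: cA => _ [_ []]. Qed.
Lemma nrmM x y : nrm (x * y) <= nrm x * nrm y.
Proof. by case: cA => _ [_ []]. Qed.
Lemma nrmC x : nrm (star x * x) = nrm x ^+ 2. Proof. by case: cA. Qed.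
Lemma starK x : star (star x) = x. Proof. by case: cA => _ _ []. Qed.
Lemma starD x y : star (x + y) = star x + star y.
Proof. by case: cA => _ _ []. Qed.
Lemma starZ c x : star (c *: x) = conjc c *: star x.
Proof. by case: cA => _ _ []. Qed.
Lemma starM x y : star (x * y) = star y * star x.
Proof. by case: cA => _ _ []. Qed.

Lemma star1 : star 1 = 1.
Proof. by rewrite -[in RHS](starK 1) -[star 1 in RHS]mulr1 starM starK mulr1. Qed.

Lemma starN x : star (- x) = - star x.
Proof. by rewrite -scaleN1r starZ rmorphN rmorph1 scaleN1r. Qed.

Lemma starB x y : star (x - y) = star x - star y.
Proof. by rewrite starD starN. Qed.

Lemma star0 : star 0 = 0.
Proof. by rewrite -{1}(subrr (0 : A)) starB subrr. Qed.

Lemma star_rCZ (r : R) x : star (rC r *: x) = rC r *: star x.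
Proof. by rewrite starZ conjc_rC. Qed.

Lemma sa_rCZ (r : R) x : sa star x -> sa star (rC r *: x).
Proof. by rewrite /sa star_rCZ => ->. Qed.

Lemma nrm0 : nrm 0 = 0.
Proof. by rewrite -(scale0r 0) nrmZ cabs0 mul0r. Qed.

Lemma nrmN x : nrm (- x) = nrm x.
Proof. by rewrite -scaleN1r nrmZ cabsN -[1]/(rC 1) cabs_rC normr1 mul1r. Qed.

Lemma nrmB x y : nrm (x - y) <= nrm x + nrm y.
Proof. by rewrite -(nrmN y) nrmD. Qed.

Lemma nrm_distC x y : nrm (x - y) = nrm (y - x).
Proof. by rewrite -nrmN opprB. Qed.

Lemma nrm_rCZ (r : R) x : 0 <= r -> nrm (rC r *: x) = r * nrm x.
Proof. by move=> r0; rewrite nrmZ cabs_rC ger0_norm. Qed.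

(** The C*-identity gives [nrm y ^+ 2 <= nrm (star y) * nrm y]; cancel a factor, then apply this to
    [star y] as well. *)
Lemma nrm_star x : nrm (star x) = nrm x.
Proof.
have le_star y : nrm y <= nrm (star y).
  have := nrmM (star y) y; rewrite nrmC expr2.
  have [->|ny] := eqVneq (nrm y) 0; first by rewrite nrm_ge0.
  by rewrite ler_pM2r // lt_neqAle eq_sym ny nrm_ge0.
by apply/eqP; rewrite eq_le le_star andbT -{2}(starK x) le_star.
Qed.

Lemma nrm1 : nrm 1 = 1.
Proof.
have := nrmC 1; rewrite star1 mulr1 expr2 => /esym/eqP.
rewrite -subr_eq0 -{3}[nrm 1]mulr1 -mulrBr mulf_eq0 => /orP[/eqP/nrm0_eq0/eqP|].
  by rewrite oner_eq0.
by rewrite subr_eq0 => /eqP.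
Qed.

Lemma nrm_isometry u : star u * u = 1 -> nrm u = 1.
Proof.
move=> uu; have := nrmC u; rewrite uu nrm1 => /esym/eqP.
by rewrite sqrf_eq1 => /orP[/eqP //|/eqP h]; have := nrm_ge0 u; rewrite h ler0N1.
Qed.

(** Serves to prove identities for a limit, which are first obtained up to a fixed multiple of an
    arbitrary [e]. *)
Lemma nrm_small_eq0 (x : A) (K : R) :
  0 <= K -> (forall e, 0 < e -> nrm x <= K * e) -> x = 0.
Proof.
move=> K0 h; apply: nrm0_eq0; apply/eqP; rewrite eq_le nrm_ge0 andbT.
rewrite leNgt; apply/negP => xp.
have K1 : 0 < K + 1 by lra.
have := h (nrm x / (K + 1)) (divr_gt0 xp K1).
rewrite mulrA ler_pdivlMr //; nra.
Qed.

(* The iteration is a contraction of factor q on the ball of radius q, and its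
   fixed point l satisfies (1 - l)^2 = 1 - h. *)
Lemma cstar_sqrt1B (h : A) (q : R) : sa star h -> nrm h <= q -> q < 1 ->
  exists c, [/\ sa star c, c * c = 1 - h & forall k, k * h = h * k -> k * c = c * k].
Proof.
move=> sah hq q1.
have q0 : 0 <= q := le_trans (nrm_ge0 h) hq.
pose f y := (2^-1 : R[i]) *: (h + y * y).
pose y n := iter n f 0.
have f_lip a b : nrm (f a - f b) <= 2^-1 * ((nrm a + nrm b) * nrm (a - b)).
  rewrite /f -scalerBr nrmZ cabs_half ler_pM2l ?invr_gt0 //.
  have -> : h + a * a - (h + b * b) = a * (a - b) + (a - b) * b.
    by rewrite mulrBr mulrBl opprD addrACA subrr add0r addrA subrK.
  by apply: le_trans (nrmD _ _) _; apply: le_trans (lerD (nrmM _ _) (nrmM _ _)) _; lra.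
have y_le n : nrm (y n) <= q.
  elim: n => [|n IH]; first by rewrite nrm0.
  rewrite /= -/(y n) /f nrmZ cabs_half.
  have := nrmD h (y n * y n); have := nrmM (y n) (y n).
  have := nrm_ge0 (y n); nra.
(* [y (n + k)] and [y n] are the [n]-th iterates of [f] at [y k] and at [0], so their distance
   shrinks by [q] at each step. *)
have y_cauchy n k : nrm (y (n + k)%N - y n) <= q ^+ n.
  elim: n => [|n IH].
    by rewrite add0n subr0 expr0; apply: le_trans (y_le k) _; exact: ltW.
  rewrite addSn /= -/(y _) -/(y n); apply: le_trans (f_lip _ _) _.
  rewrite exprS; apply: le_trans (_ : q * nrm (y (n + k)%N - y n) <= _); last first.
    by rewrite ler_wpM2l.
  rewrite mulrA ler_wpM2r ?nrm_ge0 //.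
  have := y_le n; have := y_le (n + k)%N; lra.
have y_small e : 0 < e -> exists N, forall m n, (N <= m)%N -> (N <= n)%N ->
    nrm (y m - y n) < e.
  move=> e0; have [N hN] := expr_lt_eps q0 q1 e0; exists N => m n Nm Nn.
  have [mn|/ltnW nm] := leqP n m.
    by rewrite -(subnKC mn); apply: le_lt_trans (y_cauchy _ _) (hN _ Nn).
  by rewrite nrm_distC -(subnKC nm); apply: le_lt_trans (y_cauchy _ _) (hN _ Nm).
have [l hl] : exists l, forall e : R, 0 < e -> exists N, forall n, (N <= n)%N ->
    nrm (y n - l) < e by case: cA => _ _ _ _; apply.
have near_l e : 0 < e -> exists n, nrm (y n - l) < e /\ nrm (y n.+1 - l) < e.
  by move=> e0; have [N hN] := hl e e0; exists N; split; apply: hN.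
have l_le : nrm l <= 2.
  have [n [hn _]] := near_l 1 ltr01.
  have := nrmB (y n) (y n - l); rewrite subKr.
  have := y_le n; lra.
have lfix : l = f l.
  (* The two differences below are at most [(q + 2) / 2 * e] and [e], which sum to less than
     [3 * e]. *)
  apply/eqP; rewrite -subr_eq0; apply/eqP; apply: (@nrm_small_eq0 _ 3) => // e e0.
  have [n [hn hn1]] := near_l e e0.
  have -> : l - f l = (f (y n) - f l) - (y n.+1 - l).
    by rewrite /= -/(y n) opprB addrAC addrCA subrr addr0.
  apply: le_trans (nrmB _ _) _; have := f_lip (y n) l.
  have := y_le n; have := nrm_ge0 (y n); have := nrm_ge0 l; have := nrm_ge0 (y n - l).
  nra.
have sal : star l = l.
  apply/eqP; rewrite -subr_eq0; apply/eqP; apply: (@nrm_small_eq0 _ 2) => // e e0.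
  have say n : star (y n) = y n.
    elim: n => [|n IH]; first by rewrite star0.
    rewrite /= -/(y n) /f starZ starD starM IH sah.
    by congr (_ *: _); rewrite conjc_inv conjc_nat.
  have [n [hn _]] := near_l e e0.
  have -> : star l - l = (y n - l) - star (y n - l).
    by rewrite starB say opprB [RHS]addrC addrA subrK.
  by apply: le_trans (nrmB _ _) _; rewrite nrm_star; lra.
exists (1 - l); split.
- by rewrite /sa starB star1 sal.
- have : l + l = h + l * l.
    have half2 : (2^-1 + 2^-1 : R[i]) = 1 by field.
    by rewrite {1 2}lfix /f -scalerDl half2 scale1r.
  move=> e; have -> : h = l + l - l * l by rewrite e addrK.
  by rewrite mulrBl mul1r mulrBr mulr1 !opprB opprD -addrA [- l + _]addrCA.
move=> k kh; have kl : k * l = l * k; last by rewrite mulrBr mulrBl kl mulr1 mul1r.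
apply/eqP; rewrite -subr_eq0; apply/eqP; apply: (@nrm_small_eq0 _ (2 * nrm k)).
  by rewrite mulr_ge0 // nrm_ge0.
move=> e e0.
(* [y n] is a polynomial in [h], hence commutes with every [k] that commutes with [h]; so does the
   limit. *)
have ky n : k * y n = y n * k.
  elim: n => [|n IH]; first by rewrite mulr0 mul0r.
  by rewrite /= -/(y n) /f -scalerAr -scalerAl mulrDr mulrDl kh mulrA IH -!mulrA IH.
have [n [hn _]] := near_l e e0.
have -> : k * l - l * k = (y n - l) * k - k * (y n - l).
  by rewrite mulrBl mulrBr ky opprB [RHS]addrC addrA subrK.
apply: le_trans (nrmB _ _) _; apply: le_trans (lerD (nrmM _ _) (nrmM _ _)) _.
have := nrm_ge0 k; nra.
Qed.

End CStarTheory.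

(** * States: Cauchy-Schwarz and contractivity *)

Section StateTheory.
Variables (R : realType) (A : algType R[i]) (star : A -> A) (nrm : A -> R).
Hypothesis cA : is_cstar star nrm.

Lemma state_rCZ phi (r : R) x : is_state star phi -> phi (rC r *: x) = rC r * phi x.
Proof. by case. Qed.

Lemma stateN phi x : is_state star phi -> phi (- x) = - phi x.
Proof. by case=> _ sZ _ _; rewrite -scaleN1r sZ mulN1r. Qed.

Lemma stateB phi x y : is_state star phi -> phi (x - y) = phi x - phi y.
Proof. by move=> sphi; case: (sphi) => sD _ _ _; rewrite sD stateN. Qed.

Lemma is_state_convex (t : R) phi psi : 0 <= t -> t <= 1 ->
  is_state star phi -> is_state star psi ->
  is_state star (fun x => rC (1 - t) * phi x + rC t * psi x).
Proof.
move=> t0 t1 [aD aZ aP a1] [bD bZ bP b1]; split.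
- by move=> x y; rewrite aD bD; ring.
- by move=> c x; rewrite aZ bZ; ring.
- by move=> x; rewrite addr_ge0 // mulr_ge0 ?aP ?bP // rC_ge0 // subr_ge0.
- by rewrite a1 b1 !mulr1 -rCD subrK.
Qed.

(** Positivity of [phi] at [x + c *: y] for all complex [c] first gives hermitian symmetry, which is
    not an axiom in [is_state], and then the inequality through a suitable [c]. *)
Lemma state_cauchy_schwarz phi x y : is_state star phi ->
  cabs (phi (star x * y)) ^+ 2 <=
    complex.Re (phi (star x * x)) * complex.Re (phi (star y * y)).
Proof.
case=> sD sZ sP _.
have expand c : phi (star (x + c *: y) * (x + c *: y)) =
    phi (star x * x) + c * phi (star x * y) + conjc c * phi (star y * x)
    + conjc c * c * phi (star y * y).
  have -> : star (x + c *: y) * (x + c *: y) =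
      star x * x + c *: (star x * y) +
      (conjc c *: (star y * x) + conjc c *: (c *: (star y * y))).
    by rewrite (starD cA) (starZ cA) mulrDl !mulrDr -!scalerAl -!scalerAr.
  by rewrite !sD !sZ; ring.
have px := sP x; have py := sP y.
have pos c := sP (x + c *: y).
move: px py pos expand; rewrite cabs_sqr.
case: (phi (star x * x)) => p p'; case: (phi (star y * y)) => q q'.
case: (phi (star x * y)) => z1 z2; case: (phi (star y * x)) => w1 w2.
rewrite !lecE /= => /andP[/eqP p'0 p0] /andP[/eqP q'0 q0] pos expand.
have {pos expand} pos c1 c2 :
    (c1 * z2 + c2 * z1 + (c1 * w2 - c2 * w1) = 0) /\
    0 <= p + (c1 * z1 - c2 * z2) + (c1 * w1 + c2 * w2) + (c1 ^+ 2 + c2 ^+ 2) * q.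
  have := pos (Complex c1 c2); rewrite expand lecE /= p'0 q'0 => /andP[/eqP h1 h2].
  split; first by rewrite -h1; ring.
  by apply: le_trans h2 _; rewrite le_eqVlt; apply/orP; left; apply/eqP; ring.
(* The imaginary part must vanish at [c = 1] and at [c = i], which makes [phi (star y * x)] the
   conjugate of [phi (star x * y)]. *)
have [e1 _] := pos 1 0; have [e2 _] := pos 0 1.
have w1E : w1 = z1 by lra.
have w2E : w2 = - z2 by lra.
set N := z1 ^+ 2 + z2 ^+ 2.
have N0 : 0 <= N by rewrite addr_ge0 // sqr_ge0.
(* The choice [c = - s * conjc z], with [z = phi (star x * y)], turns positivity into a quadratic in
   the real number [s]. *)
have key s : 0 <= p - 2 * s * N + s ^+ 2 * N * q.
  have [_] := pos (- s * z1) (s * z2); rewrite w1E w2E.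
  by congr (0 <= _); rewrite /N; ring.
have [q00|qn0] := eqVneq q 0.
  rewrite q00 mulr0 leNgt; apply/negP => Np.
  (* If [q = 0] the expression is affine in [s], and for [N > 0] this [s] would give it the value
     [-1]. *)
  have := key ((p + 1) / (2 * N)).
  have -> : 2 * ((p + 1) / (2 * N)) * N = p + 1 by field; exact: lt0r_neq0.
  by rewrite q00 mulr0; lra.
have qp : 0 < q by rewrite lt_neqAle eq_sym qn0.
have := key q^-1.
have -> : p - 2 * q^-1 * N + q^-1 ^+ 2 * N * q = p - N / q by field.
by rewrite subr_ge0 ler_pdivrMr.
Qed.

(** For [t > nrm h] the element [1 - h / t] is a square [c * c] with [c] selfadjoint, so [phi] is
    nonnegative on it and [phi h] has real part at most [t]. *)
Lemma state_sa_le phi h : is_state star phi -> sa star h ->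
  complex.Re (phi h) <= nrm h.
Proof.
move=> sphi sah; apply/ler_addgt0Pr => e e0.
have h0 := nrm_ge0 cA h.
have t0 : 0 < nrm h + e by lra.
set t := nrm h + e in t0 *.
have [c [sac cc _]] : exists c, [/\ sa star c, c * c = 1 - rC t^-1 *: h &
    forall k, k * (rC t^-1 *: h) = (rC t^-1 *: h) * k -> k * c = c * k].
  apply: (@cstar_sqrt1B _ _ _ _ cA _ (t^-1 * nrm h)).
  - exact: (sa_rCZ cA).
  - by rewrite (nrm_rCZ cA) // invr_ge0 ltW.
  - by rewrite mulrC ltr_pdivrMr // /t; lra.
case: (sphi) => _ _ /(_ c) + s1.
rewrite sac cc (stateB _ _ sphi) s1 state_rCZ // lecE => /andP[_].
rewrite ReB Re_rCM /= subr_ge0 mulrC ler_pdivrMr //; lra.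
Qed.

(** Cauchy-Schwarz against [1] reduces to the selfadjoint element [star x * x], of norm
    [nrm x ^+ 2]. *)
Lemma state_le phi x : is_state star phi -> cabs (phi x) <= nrm x.
Proof.
move=> sphi; rewrite -(@ler_pXn2r _ 2) ?nnegrE ?cabs_ge0 ?(nrm_ge0 cA) //.
have := state_cauchy_schwarz 1 x sphi; rewrite (star1 cA) !mul1r.
case: (sphi) => _ _ _ ->; rewrite mul1r => h; apply: le_trans h _.
rewrite -(nrmC cA); apply: state_sa_le => //.
by rewrite /sa (starM cA) (starK cA).
Qed.

Lemma state_dist_le phi psi x : is_state star phi -> is_state star psi ->
  cabs (phi x - psi x) <= 2 * nrm x.
Proof.
move=> sphi spsi; apply: le_trans (cabsB _ _) _.
by have := state_le x sphi; have := state_le x spsi; lra.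
Qed.

End StateTheory.

(** * Contractivity of unital star-homomorphisms *)

Section StarMorphism.
Variables (R : realType) (A D : algType R[i]).
Variables (sA : A -> A) (nA : A -> R) (sD : D -> D) (nD : D -> R) (f : A -> D).
Hypotheses (cA : is_cstar sA nA) (cD : is_cstar sD nD).
Hypothesis hf : is_unital_star_monomorphism sA sD f.

Lemma is_state_comp phi : is_state sD phi -> is_state sA (phi \o f).
Proof.
case: hf => fD fZ [fM f1] fs _ [pD pZ pP p1]; split => /=.
- by move=> x y; rewrite fD pD.
- by move=> c x; rewrite fZ pZ.
- by move=> x; rewrite fM fs pP.
- by rewrite f1.
Qed.

(* A selfadjoint strict contraction k is the real part of the unitary
   k + i sqrt(1 - k^2), and f maps isometries to isometries. *)
Lemma morph_sa_contractive h : sa sA h -> nD (f h) <= nA h.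
Proof.
case: hf => fD fZ [fM f1] fs _ sah; apply/ler_addgt0Pr => e e0.
have h0 := nrm_ge0 cA h.
have t0 : 0 < nA h + e by lra.
set t := nA h + e in t0 *.
have [k kdef] : exists k, k = rC t^-1 *: h by eexists.
have sak : sA k = k by rewrite kdef; exact: (sa_rCZ cA).
have k0 := nrm_ge0 cA k.
have k1 : nA k < 1.
  by rewrite kdef (nrm_rCZ cA) ?invr_ge0 ?(ltW t0) // mulrC ltr_pdivrMr // /t; lra.
have [c [sac cc kc]] : exists c, [/\ sa sA c, c * c = 1 - k * k &
    forall x, x * (k * k) = (k * k) * x -> x * c = c * x].
  apply: (@cstar_sqrt1B _ _ _ _ cA _ (nA k * nA k)).
  - by rewrite /sa (starM cA) sak.
  - exact: (nrmM cA).
  - by nra.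
(* [k] commutes with [k * k], hence with [c]; this cancels the cross terms of [sA u * u]. *)
have {}kc : k * c = c * k by apply: kc; rewrite mulrA.
have ii : iC R * iC R = -1 by rewrite /iC; simpc.
have ic : conjc (iC R) = - iC R by rewrite /iC /=; simpc.
pose u := k + iC R *: c.
have su : sA u = k - iC R *: c.
  by rewrite (starD cA) sak (starZ cA) sac ic scaleNr.
have uu : sA u * u = 1.
  rewrite su /u mulrDr !mulrBl -!scalerAl -!scalerAr scalerA ii scaleN1r opprK.
  by rewrite kc cc addrA subrK addrCA subrr addr0.
have kE : k = (2^-1 : R[i]) *: (u + sA u).
  have half2 : (2^-1 + 2^-1 : R[i]) = 1 by field.
  by rewrite su /u addrACA subrr addr0 scalerDr -scalerDl half2 scale1r.
have fu1 : nD (f u) = 1.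
  by apply: (nrm_isometry cD); rewrite -fs -fM uu.
have fk : nD (f k) <= 1.
  rewrite kE fZ fD fs (nrmZ cD) cabs_half.
  by have := nrmD cD (f u) (sD (f u)); rewrite (nrm_star cD) fu1; lra.
have -> : h = rC t *: k by rewrite kdef scalerA rCVK ?lt0r_neq0 // scale1r.
by rewrite fZ (nrm_rCZ cD) ?(ltW t0) //; nra.
Qed.

End StarMorphism.

(** * Lip-norms and the Monge-Kantorovich metric *)

Section LipschitzSeminorm.
Variables (R : realType) (A : algType R[i]) (star : A -> A) (nrm : A -> R).
Hypothesis cA : is_cstar star nrm.
Variable L : A -> \bar R.

Lemma mk_leP phi psi (k : R) : (mk star L phi psi <= k%:E)%E <->
  forall a, Lip1 star L a -> cabs (phi a - psi a) <= k.
Proof.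
split=> [/ereal_supP h a La|h].
  by rewrite -lee_fin; apply: h; exists a.
by apply/ereal_supP => _ [a La <-]; rewrite lee_fin; exact: h.
Qed.

Lemma mk_lt phi psi (k : R) a : (mk star L phi psi < k%:E)%E ->
  Lip1 star L a -> cabs (phi a - psi a) < k.
Proof.
move=> h La; rewrite -lte_fin; apply: le_lt_trans h.
by apply: ereal_sup_ubound; exists a.
Qed.

(** A positive bound [l] replaces [L b], by which one cannot divide when it vanishes. *)
Lemma lip1_rescale (l : R) b :
  (forall (r : R) a, L (rC r *: a) = (`|r|%:E * L a)%E) ->
  0 < l -> sa star b -> (L b <= l%:E)%E -> Lip1 star L (rC l^-1 *: b).
Proof.
move=> LZ l0 sab Lb; split; first exact: (sa_rCZ cA).
have li : 0 < l^-1 by rewrite invr_gt0.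
rewrite LZ gtr0_norm //.
apply: le_trans (lee_wpmul2l _ Lb) _; first by rewrite lee_fin ltW.
by rewrite -EFinM mulVf ?lt0r_neq0.
Qed.

(** A selfadjoint element is close to some [b] with [L b] finite; [mk] controls [phi b - psi b]
    after rescaling, and contractivity of states controls the rest. *)
Lemma mk_weak_star_continuous :
  (forall a, (L a < +oo)%E -> sa star a) -> (forall a, (0 <= L a)%E) ->
  (forall (r : R) a, L (rC r *: a) = (`|r|%:E * L a)%E) ->
  (forall a, sa star a -> forall e : R, 0 < e ->
     exists b, (L b < +oo)%E /\ nrm (a - b) < e) ->
  forall phi, is_state star phi -> forall (a : A) (d : R), 0 < d ->
    exists e : R, 0 < e /\
      forall psi, is_state star psi -> (mk star L phi psi < e%:E)%E ->
        cabs (phi a - psi a) < d.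
Proof.
move=> Lsa L0 LZ Ldense phi sphi.
have sa_case x d : sa star x -> 0 < d -> exists e : R, 0 < e /\
    forall psi, is_state star psi -> (mk star L phi psi < e%:E)%E ->
      cabs (phi x - psi x) < d.
  move=> sax d0; have d4 : 0 < d / 4 by rewrite divr_gt0.
  have [b [Lb xb]] := Ldense x sax _ d4.
  have [m m0 Lbm] : exists2 m : R, 0 <= m & L b = m%:E.
    by move: Lb (L0 b); case: (L b) => // m _ m0; exists m.
  have l0 : 0 < m + 1 by lra.
  (* This [e] allows [d / 2] for [b]; replacing [x] by [b] costs [d / 4] for each of the two states.
     Using [m + 1] avoids dividing by zero. *)
  exists (d / (2 * (m + 1))); split; first by rewrite divr_gt0 // mulr_gt0.
  move=> psi spsi hmk.
  have lip : Lip1 star L (rC (m + 1)^-1 *: b).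
    by apply: lip1_rescale => //; [exact: Lsa | rewrite Lbm lee_fin; lra].
  have := mk_lt hmk lip; rewrite !(@state_rCZ _ _ star) // -mulrBr cabsZ; last first.
    by rewrite invr_ge0 ltW.
  rewrite mulrC ltr_pdivrMr //.
  have -> : d / (2 * (m + 1)) * (m + 1) = d / 2 by field; exact: lt0r_neq0.
  move=> hb; apply: le_lt_trans (cabs_dist_trans (phi b) _ _) _.
  apply: le_lt_trans (lerD (lexx _) (cabs_dist_trans (psi b) _ _)) _.
  have := state_le cA (x - b) sphi; have := state_le cA (x - b) spsi.
  rewrite (stateB _ _ sphi) (stateB _ _ spsi) (cabs_distC (psi x)); lra.
move=> x d d0.
(* [p] and [- q] are twice the real and imaginary parts of [x], so [x = (p - i q) / 2]. *)
pose p := x + star x; pose q := iC R *: (x - star x).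
have sap : sa star p by rewrite /sa /p (starD cA) (starK cA) addrC.
have ic : conjc (iC R) = - iC R by rewrite /iC /=; simpc.
have ii : iC R * iC R = -1 by rewrite /iC; simpc.
have saq : sa star q.
  by rewrite /sa /q (starZ cA) (starB cA) (starK cA) ic scaleNr -scalerN opprB.
have xE : x = (2^-1 : R[i]) *: (p - iC R *: q).
  have half2 : (2^-1 + 2^-1 : R[i]) = 1 by field.
  rewrite /p /q scalerA ii scaleN1r opprK addrACA subrr addr0.
  by rewrite scalerDr -scalerDl half2 scale1r.
have [e1 [e10 h1]] := sa_case p d sap d0.
have [e2 [e20 h2]] := sa_case q d saq d0.
exists (Num.min e1 e2); split; first by rewrite lt_min e10.
move=> psi spsi hmk.
have hp : cabs (phi p - psi p) < d.
  by apply: h1 => //; apply: lt_le_trans hmk _; rewrite lee_fin ge_min lexx.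
have hq : cabs (phi q - psi q) < d.
  by apply: h2 => //; apply: lt_le_trans hmk _; rewrite lee_fin ge_min lexx orbT.
have -> : phi x - psi x = 2^-1 * ((phi p - psi p) - iC R * (phi q - psi q)).
  rewrite [in LHS]xE; case: (sphi) => _ aZ _ _; case: (spsi) => _ bZ _ _.
  by rewrite aZ bZ (stateB _ _ sphi) (stateB _ _ spsi) aZ bZ; ring.
rewrite cabsM cabs_half.
have := cabsB (phi p - psi p) (iC R * (phi q - psi q)).
by rewrite cabsM cabs_iC mul1r; lra.
Qed.

(* Weak* continuity of mk at phi0 bounds mk phi0 ((1 - t) phi0 + t psi), which
   is t * mk phi0 psi, uniformly in psi for small t; no compactness is needed. *)
Lemma mk_bounded phi0 : is_qcms star nrm L -> is_state star phi0 ->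
  exists K : R, forall psi, is_state star psi ->
    forall a, Lip1 star L a -> cabs (phi0 a - psi a) <= K.
Proof.
case=> _ _ _ _ [_ /(_ phi0) hcont _] s0.
have [s [d [d0 hd]]] := hcont s0 1 ltr01.
have [M [M0 hM]] := seq_bounded nrm s.
have den0 : 0 < d + 2 * M + 1 by lra.
(* [M] bounds the norms of the test elements, on which the combination moves [phi0] by at most
   [t * (2 * M)]; this [t] makes that less than [d]. *)
pose t := d / (d + 2 * M + 1).
have t0 : 0 < t by rewrite divr_gt0.
have t1 : t <= 1 by rewrite ler_pdivrMr //; lra.
have tM : t * (2 * M) < d.
  by rewrite /t mulrAC ltr_pdivrMr //; nra.
exists t^-1 => psi spsi a La.
have schi := is_state_convex (ltW t0) t1 s0 spsi.
have diff x : phi0 x - (rC (1 - t) * phi0 x + rC t * psi x) =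
    rC t * (phi0 x - psi x).
  by rewrite rCB rC1; ring.
have hmk := hd _ schi.
have {}hmk : (mk star L phi0 (fun x => rC (1 - t) * phi0 x + rC t * psi x)%R
    < 1%:E)%E.
  apply: hmk => x xs; rewrite diff cabsZ ?(ltW t0) //.
  apply: le_lt_trans tM; rewrite ler_pM2l //.
  apply: le_trans (state_dist_le cA x s0 spsi) _.
  by rewrite ler_pM2l // hM.
have := mk_lt hmk La; rewrite diff cabsZ ?(ltW t0) // => /ltW.
by rewrite -[t^-1]mul1r ler_pdivlMr // mulrC.
Qed.

Lemma lip1_0 : is_qcms star nrm L -> Lip1 star L 0.
Proof.
case=> _ _ _ Lker _; split; first exact: (star0 cA).
have -> : L 0 = 0%E by apply/Lker; exists 0; rewrite rC0 scale0r.
by rewrite lee_fin.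
Qed.

Lemma mk_diameter phi0 : is_qcms star nrm L -> is_state star phi0 ->
  exists K : R, forall phi psi, is_state star phi -> is_state star psi ->
    forall a, Lip1 star L a -> cabs (phi a - psi a) <= K.
Proof.
move=> qL s0; have [K hK] := mk_bounded qL s0; exists (K + K) => phi psi s1 s2 a La.
apply: le_trans (cabs_dist_trans (phi0 a) _ _) (lerD _ _); last exact: hK.
by rewrite cabs_distC; exact: hK.
Qed.

End LipschitzSeminorm.

(** * Hausdorff distance; infima need not be attained, hence the slack *)

Section Hausdorff.
Variables (R : realType) (T : Type) (d : T -> T -> \bar R) (X Y : set T).

Lemma haus_lt_left (r r' : \bar R) x : (haus d X Y <= r)%E -> (r < r')%E -> X x ->
  exists2 y, Y y & (d x y < r')%E.
Proof.
rewrite /haus ge_max => /andP[/ereal_supP h _] rr' Xx.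
have /ereal_inf_lt[_ [y Yy <-] ylt] : (ereal_inf [set d x y | y in Y] < r')%E.
  by apply: le_lt_trans rr'; apply: h; exists x.
by exists y.
Qed.

Lemma haus_lt_right (r r' : \bar R) y : (haus d X Y <= r)%E -> (r < r')%E -> Y y ->
  exists2 x, X x & (d x y < r')%E.
Proof.
rewrite /haus ge_max => /andP[_ /ereal_supP h] rr' Yy.
have /ereal_inf_lt[_ [x Xx <-] xlt] : (ereal_inf [set d x y | x in X] < r')%E.
  by apply: le_lt_trans rr'; apply: h; exists y.
by exists x.
Qed.

Lemma haus_le (r : R) :
  (forall x e, X x -> 0 < e -> exists2 y, Y y & (d x y <= (r + e)%:E)%E) ->
  (forall y e, Y y -> 0 < e -> exists2 x, X x & (d x y <= (r + e)%:E)%E) ->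
  (haus d X Y <= r%:E)%E.
Proof.
move=> hX hY; rewrite /haus ge_max; apply/andP; split; apply/ereal_supP.
  move=> _ [x Xx <-]; apply/lee_addgt0Pr => e e0.
  have [y Yy dxy] := hX x e Xx e0.
  by apply: ge_ereal_inf; exists (d x y) => //; exists y.
move=> _ [y Yy <-]; apply/lee_addgt0Pr => e e0.
have [x Xx dxy] := hY y e Yy e0.
by apply: ge_ereal_inf; exists (d x y) => //; exists x.
Qed.

End Hausdorff.

(** * The direct sum as a C*-algebra *)

Section DirectSum.
Variables (R : realType) (A B : algType R[i]).
Variables (sA : A -> A) (nA : A -> R) (sB : B -> B) (nB : B -> R).
Hypotheses (cA : is_cstar sA nA) (cB : is_cstar sB nB).

Let nA_le (x : (A * B)%type) : nA x.1 <= sum_norm nA nB x.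
Proof. by rewrite /sum_norm le_max lexx. Qed.

Let nB_le (x : (A * B)%type) : nB x.2 <= sum_norm nA nB x.
Proof. by rewrite /sum_norm le_max lexx orbT. Qed.

Lemma is_cstar_sum : @is_cstar R (A * B)%type (sum_star sA sB) (sum_norm nA nB).
Proof.
split.
- split=> [x|x x0]; first exact: le_trans (nrm_ge0 cA _) (nA_le x).
  case: x x0 => a b x0.
  have a0 : nA a <= 0 by have := nA_le (a, b); rewrite x0.
  have b0 : nB b <= 0 by have := nB_le (a, b); rewrite x0.
  rewrite (@nrm0_eq0 _ _ _ _ cA a); last by apply/le_anti; rewrite a0 (nrm_ge0 cA).
  by rewrite (@nrm0_eq0 _ _ _ _ cB b) //; apply/le_anti; rewrite b0 (nrm_ge0 cB).
- split; [|split].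
  + move=> x y; rewrite {1}/sum_norm ge_max; apply/andP; split.
      exact: le_trans (nrmD cA _ _) (lerD (nA_le _) (nA_le _)).
    exact: le_trans (nrmD cB _ _) (lerD (nB_le _) (nB_le _)).
  + by move=> c x; rewrite /sum_norm (nrmZ cA) (nrmZ cB) maxr_pMr // cabs_ge0.
  + move=> x y; rewrite {1}/sum_norm ge_max; apply/andP; split.
      apply: le_trans (nrmM cA _ _) _.
      by apply: ler_pM; rewrite ?nA_le ?(nrm_ge0 cA).
    apply: le_trans (nrmM cB _ _) _.
    by apply: ler_pM; rewrite ?nB_le ?(nrm_ge0 cB).
- split.
  + by move=> [a b]; rewrite /sum_star /= (starK cA) (starK cB).
  + by move=> x y; rewrite /sum_star /= (starD cA) (starD cB).
  + by move=> c x; rewrite /sum_star /= (starZ cA) (starZ cB).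
  + by move=> x y; rewrite /sum_star /= (starM cA) (starM cB).
- move=> x; rewrite /sum_norm /= (nrmC cA) (nrmC cB).
  have := nrm_ge0 cA x.1; have := nrm_ge0 cB x.2.
  by case: (leP (nA x.1) (nB x.2)) => h b0 a0;
    [rewrite (max_idPr _) //|rewrite (max_idPl _) //];
    rewrite ler_pXn2r ?nnegrE // ltW.
move=> u hu.
have [a ha] : exists a, forall e : R, 0 < e -> exists N, forall n, (N <= n)%N ->
    nA ((u n).1 - a) < e.
  case: cA => _ _ _ _; apply=> e e0; have [N hN] := hu e e0; exists N => m n Nm Nn.
  by apply: le_lt_trans (nA_le (u m - u n)) _; exact: hN.
have [b hb] : exists b, forall e : R, 0 < e -> exists N, forall n, (N <= n)%N ->
    nB ((u n).2 - b) < e.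
  case: cB => _ _ _ _; apply=> e e0; have [N hN] := hu e e0; exists N => m n Nm Nn.
  by apply: le_lt_trans (nB_le (u m - u n)) _; exact: hN.
exists (a, b) => e e0.
have [N hN] := ha e e0; have [N' hN'] := hb e e0; exists (maxn N N') => n.
rewrite geq_max => /andP[Nn N'n].
by rewrite /sum_norm gt_max hN ?hN'.
Qed.

End DirectSum.

(* [j] is not assumed unital: this is meant for the embedding of a summand. *)
Lemma state_corner (R : realType) (A S : algType R[i]) (sA : A -> A) (nA : A -> R)
  (sS : S -> S) (nS : S -> R) (j : A -> S) (phi0 : A -> R[i]) (Phi : S -> R[i]) :
  is_cstar sA nA -> is_cstar sS nS ->
  (forall x y, j (x + y) = j x + j y) -> (forall (c : R[i]) x, j (c *: x) = c *: j x) ->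
  (forall x y, j (x * y) = j x * j y) -> (forall x, j (sA x) = sS (j x)) ->
  is_state sA phi0 -> is_state sS Phi ->
  exists t phi, [/\ 0 <= t, is_state sA phi & forall a, Phi (j a) = rC t * phi a].
Proof.
move=> cA cS jD jZ jM js s0 sPhi; case: (sPhi) => PD PZ PP P1.
have j1s : sS (j 1) = j 1 by rewrite -js (star1 cA).
have p1 : 0 <= Phi (j 1).
  have -> : j 1 = sS (j 1) * j 1 by rewrite j1s -jM mulr1.
  exact: PP.
pose t := complex.Re (Phi (j 1)).
have tE : Phi (j 1) = rC t by exact: ge0_rC.
have t0 : 0 <= t by rewrite -rC_ge0 -tE.
exists t; have [tz|tn0] := eqVneq t 0.
  (* If [Phi (j 1) = 0], Cauchy-Schwarz for [sS (j 1) * j a = j a] makes [Phi] vanish on the image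
     of [j], and any state will do. *)
  exists phi0; split=> // a; rewrite tz rC0 mul0r.
  have := state_cauchy_schwarz cS (j 1) (j a) sPhi.
  rewrite j1s -!jM mul1r mulr1 tE /= tz mul0r => h.
  apply: Normc.eq0_normc; apply/eqP; rewrite -sqrf_eq0.
  by apply/eqP/le_anti; rewrite h sqr_ge0.
exists (fun a => rC t^-1 * Phi (j a)); split=> //; last first.
  by move=> a; rewrite mulrA rCVK // mul1r.
split.
- by move=> x y; rewrite jD PD mulrDr.
- by move=> c x; rewrite jZ PZ mulrCA.
- by move=> x; rewrite jM js mulr_ge0 // ?PP // rC_ge0 invr_ge0.
- by rewrite tE mulrC rCVK.
Qed.

(** * States of the direct sum *)

Section DirectSumStates.
Variables (R : realType) (A B : algType R[i]).
Variables (sA : A -> A) (nA : A -> R) (sB : B -> B) (nB : B -> R).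
Hypotheses (cA : is_cstar sA nA) (cB : is_cstar sB nB).

(** Restricting [Phi] to each summand gives a nonnegative multiple of a state, and the multiples add
    up to [Phi 1 = 1]. The states [phi0] and [psi0] stand in when a multiple is zero. *)
Lemma state_sum_decomp (phi0 : A -> R[i]) (psi0 : B -> R[i])
    (Phi : (A * B)%type -> R[i]) :
  is_state sA phi0 -> is_state sB psi0 -> is_state (sum_star sA sB) Phi ->
  exists t phi psi, [/\ 0 <= t <= 1, is_state sA phi, is_state sB psi &
    forall x, Phi x = rC t * phi x.1 + rC (1 - t) * psi x.2].
Proof.
move=> s0 r0 sPhi; have cS := is_cstar_sum cA cB.
have [t [phi [t0 sphi phiE]]] : exists t phi, [/\ 0 <= t, is_state sA phi &
    forall a, Phi (a, 0) = rC t * phi a].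
  apply: (@state_corner _ A (A * B)%type _ _ _ _ (fun a => (a, 0))
    _ _ cA cS _ _ _ _ s0 sPhi).
  - by move=> x y; rewrite -[RHS]/(x + y, 0 + 0) addr0.
  - by move=> c x; rewrite -[RHS]/(c *: x, c *: 0) scaler0.
  - by move=> x y; rewrite -[RHS]/(x * y, 0 * 0) mulr0.
  - by move=> x; rewrite /sum_star /= (star0 cB).
have [t' [psi [t'0 spsi psiE]]] : exists t psi, [/\ 0 <= t, is_state sB psi &
    forall b, Phi (0, b) = rC t * psi b].
  apply: (@state_corner _ B (A * B)%type _ _ _ _ (fun b => (0, b))
    _ _ cB cS _ _ _ _ r0 sPhi).
  - by move=> x y; rewrite -[RHS]/(0 + 0, x + y) addr0.
  - by move=> c x; rewrite -[RHS]/(c *: 0, c *: x) scaler0.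
  - by move=> x y; rewrite -[RHS]/(0 * 0, x * y) mulr0.
  - by move=> x; rewrite /sum_star /= (star0 cA).
case: (sPhi) => PD _ _ P1.
have PE x : Phi x = rC t * phi x.1 + rC t' * psi x.2.
  rewrite -phiE -psiE -PD; congr (Phi _).
  by case: x => a b; rewrite -[RHS]/(a + 0, 0 + b) addr0 add0r.
have t'E : t' = 1 - t.
  have := PE 1; rewrite P1 /=; case: (sphi) => _ _ _ ->; case: (spsi) => _ _ _ ->.
  by rewrite !mulr1 -rCD => -[->]; rewrite addrAC subrr add0r.
exists t, phi, psi; split=> //; last by move=> x; rewrite PE t'E.
by rewrite t0 -subr_ge0 -t'E.
Qed.

End DirectSumStates.

(* Closeness of unnormalised states [t phi] and [t' phi'] controls
   [t * mk phi phi']; the factor [t] makes the case [t = 0] harmless. *)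
Lemma mk_corner_close (R : realType) (A : algType R[i]) (sA : A -> A) (nA : A -> R)
  (LA : A -> \bar R) (phi : A -> R[i]) (t e : R) :
  is_cstar sA nA -> is_qcms sA nA LA -> is_state sA phi -> 0 <= t <= 1 -> 0 < e ->
  exists (s : seq A) (d : R), 0 < d /\
    forall t' phi', is_state sA phi' -> `|t - t'| < d ->
      (forall a, a \in s -> cabs (rC t * phi a - rC t' * phi' a) < d) ->
      forall a, Lip1 sA LA a -> t * cabs (phi a - phi' a) <= e.
Proof.
move=> cA [_ _ _ _ [_ hc _]] sphi /andP[t0 t1] e0.
have [->|tn0] := eqVneq t 0.
  by exists [::], 1; split=> // t' phi' _ _ _ a _; rewrite mul0r ltW.
have tp : 0 < t by rewrite lt_neqAle eq_sym tn0.
have [s [dA [dA0 hs]]] := hc phi sphi e e0.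
have [M [M0 hM]] := seq_bounded nA s.
have M1 : 0 < 1 + M by lra.
(* Below, [t * cabs (phi b - phi' b)] is at most [d] for closeness plus [d * M] for the change of
   weight; this [d] makes the sum [t * dA]. *)
pose d := t * dA / (1 + M).
have dE : d * (1 + M) = t * dA by rewrite /d divfK // lt0r_neq0.
have d0 : 0 < d by rewrite divr_gt0 // mulr_gt0.
exists s, d; split=> // t' phi' sphi' tt' close a La.
have /mk_lt/(_ La) h : (mk sA LA phi phi' < e%:E)%E.
  apply: hs => // b bs; rewrite -(ltr_pM2l tp) -cabsZ // -dE.
  have -> : rC t * (phi b - phi' b) =
      (rC t * phi b - rC t' * phi' b) + rC (t' - t) * phi' b.
    by rewrite rCB; ring.
  apply: le_lt_trans (cabsD _ _) _; rewrite cabsM cabs_rC distrC.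
  have := close b bs; have := state_le cA b sphi'; have := hM b bs.
  have := cabs_ge0 (phi' b); have := normr_ge0 (t - t'); nra.
have := cabs_ge0 (phi a - phi' a); nra.
Qed.

(** * Bridges and the 1-level of the pivot *)

Section BridgeLipNorm.
Variables (R : realType) (A B D : algType R[i]).
Variables (sA : A -> A) (nA : A -> R) (sB : B -> B) (nB : B -> R).
Variables (sD : D -> D) (nD : D -> R) (LA : A -> \bar R) (LB : B -> \bar R).
Variables (omega : D) (piA : A -> D) (piB : B -> D) (lam : R).
Hypotheses (cA : is_cstar sA nA) (cB : is_cstar sB nB) (cD : is_cstar sD nD).
Hypotheses (lA : is_leibniz_qcms sA nA LA) (lB : is_leibniz_qcms sB nB LB).
Hypothesis bridge : is_bridge sA sB sD omega piA piB.
Hypothesis lenE : bridge_length sA sB sD nD LA LB omega piA piB = lam%:E.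

Let qA : is_qcms sA nA LA. Proof. by case: lA. Qed.
Let qB : is_qcms sB nB LB. Proof. by case: lB. Qed.
Let mA : is_unital_star_monomorphism sA sD piA. Proof. by case: bridge. Qed.
Let mB : is_unital_star_monomorphism sB sD piB. Proof. by case: bridge. Qed.
Let cS := is_cstar_sum cA cB.

(** Cauchy-Schwarz for [x * (1 - omega)] leaves the factor [theta (sD (1 - omega) * (1 - omega))],
    which is zero. The other condition on the 1-level serves multiplication on the left. *)
Lemma level1_mulr theta x : level1 sD omega theta -> theta (x * omega) = theta x.
Proof.
case=> st t0 _; apply/eqP; rewrite eq_sym -subr_eq0 -(stateB _ _ st); apply/eqP.
have -> : x - x * omega = sD (sD x) * (1 - omega).
  by rewrite (starK cD) mulrBr mulr1.
apply: Normc.eq0_normc; apply/eqP; rewrite -sqrf_eq0; apply/eqP/le_anti.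
have := state_cauchy_schwarz cD (sD x) (1 - omega) st.
by rewrite t0 /= mulr0 => ->; rewrite sqr_ge0.
Qed.

Lemma level1_mull theta x : level1 sD omega theta -> theta (omega * x) = theta x.
Proof.
case=> st _ t0; apply/eqP; rewrite eq_sym -subr_eq0 -(stateB _ _ st); apply/eqP.
have -> : x - omega * x = sD (sD (1 - omega)) * x.
  by rewrite (starK cD) mulrBl mul1r.
apply: Normc.eq0_normc; apply/eqP; rewrite -sqrf_eq0; apply/eqP/le_anti.
have := state_cauchy_schwarz cD (sD (1 - omega)) x st.
by rewrite (starK cD) t0 /= mul0r => ->; rewrite sqr_ge0.
Qed.

Lemma level1_state theta : level1 sD omega theta -> is_state sD theta.
Proof. by case. Qed.

(** If [omega] were zero, the level condition would read [theta 1 = 0]. *)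
Lemma pivot_neq0 : 0 < nD omega.
Proof.
case: bridge => -[theta [st t0 _]] _ _; rewrite lt_neqAle (nrm_ge0 cD) andbT eq_sym.
apply/negP => /eqP/(nrm0_eq0 cD) o0; move: t0; rewrite o0 subr0 (star1 cD) mulr1.
by case: st => _ _ _ -> /eqP; rewrite oner_eq0.
Qed.

(** * The gap of a pair, an element of [D] obeying a product rule *)

Definition bridge_gap (x : (A * B)%type) : D := piA x.1 * omega - omega * piB x.2.

Lemma bridge_gapD x y : bridge_gap (x + y) = bridge_gap x + bridge_gap y.
Proof.
case: mA => fD _ _ _ _; case: mB => gD _ _ _ _.
by rewrite /bridge_gap /= fD gD mulrDl mulrDr opprD addrACA.
Qed.

Lemma bridge_gapZ (c : R[i]) x : bridge_gap (c *: x) = c *: bridge_gap x.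
Proof.
case: mA => _ fZ _ _ _; case: mB => _ gZ _ _ _.
by rewrite /bridge_gap /= fZ gZ -scalerAl -scalerAr scalerBr.
Qed.

Lemma bridge_gapB x y : bridge_gap (x - y) = bridge_gap x - bridge_gap y.
Proof. by rewrite bridge_gapD -scaleN1r bridge_gapZ scaleN1r. Qed.

(** The terms [piA x.1 * omega * piB y.2] cancel: a derivation twisted by [piA] on the left and
    [piB] on the right. *)
Lemma bridge_gapM x y : bridge_gap (x * y) =
  piA x.1 * bridge_gap y + bridge_gap x * piB y.2.
Proof.
case: mA => _ _ [fM _] _ _; case: mB => _ _ [gM _] _ _.
by rewrite /bridge_gap /= fM gM mulrBr mulrBl !mulrA addrA subrK.
Qed.

(** [LA] and [LB] vanish on every pair of scalars; the gap detects whether the two scalars agree. *)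
Lemma bridge_gap_scalar (r s : R) :
  bridge_gap (rC r *: 1, rC s *: 1) = rC (r - s) *: omega.
Proof.
case: mA => _ fZ [_ f1] _ _; case: mB => _ gZ [_ g1] _ _.
rewrite /bridge_gap /= fZ gZ f1 g1 -scalerAl -scalerAr mul1r mulr1.
by rewrite -scalerBl rCB.
Qed.

(** The product rule, with [piA] and [piB] contractive on selfadjoint elements and each coordinate
    norm at most [sum_norm]. *)
Lemma nrm_bridge_gapM x y : sa (sum_star sA sB) x -> sa (sum_star sA sB) y ->
  nD (bridge_gap (x * y)) <=
    sum_norm nA nB x * nD (bridge_gap y) + sum_norm nA nB y * nD (bridge_gap x).
Proof.
case: x y => [a b] [a' b'] [saa sab] [saa' sab'].
rewrite bridge_gapM; apply: le_trans (nrmD cD _ _) _; apply: lerD.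
  apply: le_trans (nrmM cD _ _) _; rewrite ler_wpM2r ?(nrm_ge0 cD) //=.
  apply: le_trans (morph_sa_contractive cA cD mA saa) _.
  by rewrite /sum_norm le_max lexx.
apply: le_trans (nrmM cD _ _) _; rewrite mulrC ler_wpM2r ?(nrm_ge0 cD) //=.
apply: le_trans (morph_sa_contractive cB cD mB sab') _.
by rewrite /sum_norm le_max lexx orbT.
Qed.

Lemma level1_gap theta x : level1 sD omega theta ->
  cabs (theta (piA x.1) - theta (piB x.2)) <= nD (bridge_gap x).
Proof.
move=> lt; have st := level1_state lt.
rewrite -(level1_mulr (piA x.1) lt) -(level1_mull (piB x.2) lt) -(stateB _ _ st).
exact: (state_le cD (bridge_gap x) st).
Qed.

(** * What reach and height provide *)

Lemma reach_left a e : Lip1 sA LA a -> 0 < e ->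
  exists2 b, Lip1 sB LB b & nD (bridge_gap (a, b)) < lam + e.
Proof.
move=> La e0; have hr : (bridge_reach sA sB nD LA LB omega piA piB <= lam%:E)%E.
  by rewrite -lenE /bridge_length le_max lexx.
have lt : (lam%:E < (lam + e)%:E)%E by rewrite lte_fin ltrDl.
have Xa : [set piA a * omega | a in Lip1 sA LA] (piA a * omega) by exists a.
have [_ [b Lb <-] hb] := haus_lt_left hr lt Xa.
by exists b => //; rewrite -lte_fin.
Qed.

Lemma reach_right b e : Lip1 sB LB b -> 0 < e ->
  exists2 a, Lip1 sA LA a & nD (bridge_gap (a, b)) < lam + e.
Proof.
move=> Lb e0; have hr : (bridge_reach sA sB nD LA LB omega piA piB <= lam%:E)%E.
  by rewrite -lenE /bridge_length le_max lexx.
have lt : (lam%:E < (lam + e)%:E)%E by rewrite lte_fin ltrDl.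
have Yb : [set omega * piB b | b in Lip1 sB LB] (omega * piB b) by exists b.
have [_ [a La <-] ha] := haus_lt_right hr lt Yb.
by exists a => //; rewrite -lte_fin.
Qed.

Lemma height_left phi e : is_state sA phi -> 0 < e ->
  exists2 theta, level1 sD omega theta &
    (mk sA LA phi (theta \o piA) < (lam + e)%:E)%E.
Proof.
move=> sphi e0.
have hh : (haus (mk sA LA) (states sA) [set phi \o piA | phi in level1 sD omega]
    <= lam%:E)%E.
  by rewrite -lenE /bridge_length le_max; apply/orP; right; rewrite le_max lexx.
have lt : (lam%:E < (lam + e)%:E)%E by rewrite lte_fin ltrDl.
have [_ [theta ltheta <-] h] := haus_lt_left hh lt (sphi : states sA phi).
by exists theta.
Qed.

Lemma height_right psi e : is_state sB psi -> 0 < e ->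
  exists2 theta, level1 sD omega theta &
    (mk sB LB psi (theta \o piB) < (lam + e)%:E)%E.
Proof.
move=> spsi e0.
have hh : (haus (mk sB LB) (states sB) [set phi \o piB | phi in level1 sD omega]
    <= lam%:E)%E.
  by rewrite -lenE /bridge_length le_max; apply/orP; right; rewrite le_max lexx orbT.
have lt : (lam%:E < (lam + e)%:E)%E by rewrite lte_fin ltrDl.
have [_ [theta ltheta <-] h] := haus_lt_left hh lt (spsi : states sB psi).
by exists theta.
Qed.

(** The unit ball of [LA] contains [0], so for every [e > 0] the reach puts some norm below
    [lam + e]. *)
Lemma bridge_length_ge0 : 0 <= lam.
Proof.
apply/ler_addgt0Pr => e e0; have [b _ h] := reach_left (lip1_0 cA qA) e0.
exact: le_trans (nrm_ge0 cD _) (ltW h).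
Qed.

(** * The seminorm on the direct sum and its kernel *)

Variable eps : R.
Hypotheses (eps0 : 0 <= eps) (le0 : 0 < lam + eps).
Let L : (A * B)%type -> \bar R := bridge_lipnorm nD LA LB omega piA piB lam eps.

Lemma bridge_lipnorm_le x m : (L x <= m)%E =
  [&& (LA x.1 <= m)%E, (LB x.2 <= m)%E &
      (((lam + eps)^-1 * nD (bridge_gap x))%:E <= m)%E].
Proof. by rewrite /L /bridge_lipnorm !ge_max -andbA. Qed.

Lemma bridge_lipnorm_bounds x : [/\ (LA x.1 <= L x)%E, (LB x.2 <= L x)%E &
  (((lam + eps)^-1 * nD (bridge_gap x))%:E <= L x)%E].
Proof. by have := bridge_lipnorm_le x (L x); rewrite lexx => /esym/and3P. Qed.

Lemma bridge_lip1 x : Lip1 (sum_star sA sB) L x <->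
  [/\ Lip1 sA LA x.1, Lip1 sB LB x.2 & nD (bridge_gap x) <= lam + eps].
Proof.
case: x => a b; rewrite /Lip1 /= bridge_lipnorm_le lee_fin mulrC ler_pdivrMr // mul1r.
split=> [[[saa sab] /and3P[La Lb h]]|[[saa La] [sab Lb] h]]; first by [].
by split; [rewrite /sa /sum_star /= saa sab | apply/and3P].
Qed.

Lemma bridge_lipnorm_ge0 x : (0 <= L x)%E.
Proof.
have [h _ _] := bridge_lipnorm_bounds x; apply: le_trans h.
by case: qA => _ [].
Qed.

Lemma bridge_lipnormZ (r : R) x : L (rC r *: x) = (`|r|%:E * L x)%E.
Proof.
rewrite /L /bridge_lipnorm !maxe_pMr ?lee_fin //.
rewrite -!/(bridge_gap _) bridge_gapZ (nrmZ cD) cabs_rC mulrCA EFinM.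
by case: qA => _ [_ [-> _]] _ _ _; case: qB => _ [_ [-> _]] _ _ _.
Qed.

Lemma bridge_lipnormD x y : (L (x + y)%R <= L x + L y)%E.
Proof.
have [ax bx gx] := bridge_lipnorm_bounds x; have [ay by' gy] := bridge_lipnorm_bounds y.
rewrite bridge_lipnorm_le; apply/and3P; split.
- by case: qA => _ [_ [_ h]] _ _ _; apply: le_trans (h _ _) (leeD ax ay).
- by case: qB => _ [_ [_ h]] _ _ _; apply: le_trans (h _ _) (leeD bx by').
- apply: le_trans (leeD gx gy); rewrite -EFinD lee_fin -mulrDr bridge_gapD.
  by rewrite ler_pM2l ?invr_gt0 // (nrmD cD).
Qed.

(** The gap term is real-valued, so [L] is finite as soon as [LA] and [LB] are. *)
Lemma bridge_lipnorm_dense x : sa (sum_star sA sB) x -> forall e : R, 0 < e ->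
  exists y, (L y < +oo)%E /\ sum_norm nA nB (x - y) < e.
Proof.
case: x => a b [saa sab] e e0.
case: qA => _ _ /(_ a saa e e0)[a' [La' ha]] _ _.
case: qB => _ _ /(_ b sab e e0)[b' [Lb' hb]] _ _.
exists (a', b'); split; last by rewrite /sum_norm gt_max ha hb.
by rewrite /L /bridge_lipnorm !gt_max La' Lb' ltry.
Qed.

Lemma bridge_lipnorm_ker x : L x = 0%E <-> exists r : R, x = rC r *: 1.
Proof.
case: (qA) => _ [A0 _] _ Aker _; case: (qB) => _ [B0 _] _ Bker _.
split=> [Lx|[r ->]]; last first.
  apply/le_anti; rewrite bridge_lipnorm_ge0 andbT bridge_lipnorm_le /=.
  rewrite (_ : rC r *: 1 = (rC r *: 1, rC r *: 1)) // bridge_gap_scalar.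
  rewrite subrr rC0 scale0r (nrm0 cD) mulr0 lexx andbT.
  have -> : LA (rC r *: 1) = 0%E by apply/Aker; exists r.
  have -> : LB (rC r *: 1) = 0%E by apply/Bker; exists r.
  by rewrite lexx.
have := bridge_lipnorm_le x 0%E; rewrite Lx lexx => /esym/and3P[hA hB].
have /Aker[r xr] : LA x.1 = 0%E by apply/le_anti; rewrite hA A0.
have /Bker[s xs] : LB x.2 = 0%E by apply/le_anti; rewrite hB B0.
(* The gap of the scalars [r] and [s] has norm [|r - s|] times the norm of [omega], which is
   positive, so [r = s]. *)
rewrite (surjective_pairing x) xr xs bridge_gap_scalar (nrmZ cD) cabs_rC lee_fin.
rewrite pmulr_rle0 ?invr_gt0 // pmulr_lle0 ?pivot_neq0 // normr_le0 subr_eq0.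
by move=> /eqP ->; exists s.
Qed.

(** * Metrization of the weak* topology *)

Lemma cross_diameter : exists K : R, forall phi psi, is_state sA phi ->
  is_state sB psi -> forall x, Lip1 (sum_star sA sB) L x ->
  cabs (phi x.1 - psi x.2) <= K.
Proof.
case: bridge => -[theta ltheta] _ _; have st := level1_state ltheta.
have sa0 := is_state_comp mA st; have sb0 := is_state_comp mB st.
have [KA hA] := mk_bounded cA qA sa0; have [KB hB] := mk_bounded cB qB sb0.
(* The path goes from [phi] to [theta \o piA], across the gap to [theta \o piB], then to [psi]. *)
exists (KA + ((lam + eps) + KB)) => phi psi sphi spsi x /bridge_lip1[La Lb gap].
apply: le_trans (cabs_dist_trans (theta (piA x.1)) _ _) _; apply: lerD.
  by rewrite cabs_distC; exact: hA.
apply: le_trans (cabs_dist_trans (theta (piB x.2)) _ _) _; apply: lerD.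
  exact: le_trans (level1_gap x ltheta) gap.
exact: hB.
Qed.

Lemma bridge_lipnorm_finite_sa x : (L x < +oo)%E -> sa (sum_star sA sB) x.
Proof.
move=> Lx; rewrite /sa /sum_star.
case: (qA) => fA _ _ _ _; case: (qB) => fB _ _ _ _.
have [hA hB _] := bridge_lipnorm_bounds x.
rewrite (fA _ (le_lt_trans hA Lx)) (fB _ (le_lt_trans hB Lx)).
by case: x {Lx hA hB}.
Qed.

(** States of the direct sum are compared through their components in each summand and their
    weights; only the change of weight mixes the summands, and [cross_diameter] bounds its
    effect. *)
Lemma bridge_mk_metrizes : mk_metrizes (sum_star sA sB) L.
Proof.
case: (bridge) => -[theta ltheta] _ _; have st := level1_state ltheta.
have sa0 := is_state_comp mA st; have sb0 := is_state_comp mB st.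
have [K hK] := cross_diameter.
have decomp Phi : is_state (sum_star sA sB) Phi -> exists t phi psi,
    [/\ 0 <= t <= 1, is_state sA phi, is_state sB psi &
        forall x, Phi x = rC t * phi x.1 + rC (1 - t) * psi x.2].
  exact: (state_sum_decomp cA cB sa0 sb0).
have split_diff t t' (z z' w w' : R[i]) : 0 <= t <= 1 ->
    cabs (rC t * z + rC (1 - t) * w - (rC t' * z' + rC (1 - t') * w')) <=
    t * cabs (z - z') + ((1 - t) * cabs (w - w') + `|t - t'| * cabs (z' - w')).
  move=> /andP[t0 t1].
  have -> : rC t * z + rC (1 - t) * w - (rC t' * z' + rC (1 - t') * w') =
      rC t * (z - z') + (rC (1 - t) * (w - w') + rC (t - t') * (z' - w')).
    by rewrite !rCB rC1; ring.
  apply: le_trans (cabsD _ _) _; rewrite cabsZ // lerD2l.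
  apply: le_trans (cabsD _ _) _; rewrite cabsZ ?subr_ge0 // lerD2l.
  by rewrite cabsM cabs_rC.
split.
- move=> Phi Psi sPhi sPsi.
  have [t [phi [psi [t01 sphi spsi PhiE]]]] := decomp _ sPhi.
  have [t' [phi' [psi' [t'01 sphi' spsi' PsiE]]]] := decomp _ sPsi.
  have [KA hA] := mk_diameter cA qA sa0; have [KB hB] := mk_diameter cB qB sb0.
  suff : (mk (sum_star sA sB) L Phi Psi <= (KA + (KB + K))%:E)%E.
    by move=> h; apply: le_lt_trans h _; exact: ltry.
  apply/mk_leP => x Lx; have /bridge_lip1[La Lb _] := Lx.
  rewrite PhiE PsiE; apply: le_trans (split_diff _ _ _ _ _ _ t01) _.
  have d1 : `|t - t'| <= 1.
    by move: t01 t'01 => /andP[? ?] /andP[? ?]; rewrite ler_norml; lra.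
  case/andP: t01 => t0 t1.
  have := hA _ _ sphi sphi' _ La; have := hB _ _ spsi spsi' _ Lb.
  have := hK _ _ sphi' spsi' _ Lx.
  have := cabs_ge0 (phi x.1 - phi' x.1); have := cabs_ge0 (psi x.2 - psi' x.2).
  have := cabs_ge0 (phi' x.1 - psi' x.2); have := normr_ge0 (t - t').
  move=> n0 c0 b0 a0 hc hb ha; apply: lerD; last apply: lerD.
  + by apply: le_trans ha; rewrite ler_piMl.
  + by apply: le_trans hb; rewrite ler_piMl //; lra.
  + by apply: le_trans hc; rewrite ler_piMl.
- move=> Phi sPhi e e0.
  have [t [phi [psi [t01 sphi spsi PhiE]]]] := decomp _ sPhi.
  have e4 : 0 < e / 4 by rewrite divr_gt0.
  have t01' : 0 <= 1 - t <= 1 by case/andP: t01 => ? ?; lra.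
  have [s1 [d1 [d10 h1]]] := mk_corner_close cA qA sphi t01 e4.
  have [s2 [d2 [d20 h2]]] := mk_corner_close cB qB spsi t01' e4.
  have K0 : 0 < `|K| + 1 by rewrite ltr_wpDl.
  (* Keeps the effect of the change of weight within [e / 4]; [|K| + 1] is positive whatever the
     sign of [K]. *)
  pose d3 := e / 4 / (`|K| + 1).
  have d30 : 0 < d3 by rewrite divr_gt0.
  pose d := Num.min d1 (Num.min d2 d3).
  (* The element [(1, 0)] reads off the weight [t]; [(a, 0)] and [(0, b)] read off [t * phi a] and
     [(1 - t) * psi b]. *)
  exists ((1, 0) :: [seq (a, 0) | a <- s1] ++ [seq (0, b) | b <- s2]), d.
  split; first by rewrite !lt_min d10 d20 d30.
  move=> Psi sPsi close.
  have [t' [phi' [psi' [t'01 sphi' spsi' PsiE]]]] := decomp _ sPsi.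
  have [dd1 dd2 dd3] : [/\ d <= d1, d <= d2 & d <= d3].
    by rewrite !ge_min !lexx !orbT.
  have psi00 (f : B -> R[i]) : is_state sB f -> f 0 = 0.
    by case=> _ fZ _ _; rewrite -(scale0r 0) fZ mul0r.
  have phi00 (f : A -> R[i]) : is_state sA f -> f 0 = 0.
    by case=> _ fZ _ _; rewrite -(scale0r 0) fZ mul0r.
  have tt' : `|t - t'| < d.
    have := close (1, 0); rewrite mem_head PhiE PsiE /= !psi00 // !mulr0 !addr0.
    case: (sphi) => _ _ _ ->; case: (sphi') => _ _ _ ->.
    by rewrite !mulr1 -rCB cabs_rC; apply.
  have closeA a : a \in s1 -> cabs (rC t * phi a - rC t' * phi' a) < d1.
    move=> as1; apply: lt_le_trans dd1; have := close (a, 0).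
    rewrite PhiE PsiE /= !psi00 // !mulr0 !addr0; apply.
    by rewrite inE mem_cat map_f ?orbT.
  have closeB b : b \in s2 ->
      cabs (rC (1 - t) * psi b - rC (1 - t') * psi' b) < d2.
    move=> bs2; apply: lt_le_trans dd2; have := close (0, b).
    rewrite PhiE PsiE /= !phi00 // !mulr0 !add0r; apply.
    by rewrite inE mem_cat [_ \in map _ s2]map_f ?orbT.
  (* Three quarters of [e] leave room for the strict inequality. *)
  apply: (@le_lt_trans _ _ (e / 4 + (e / 4 + e / 4))%:E); last first.
    by rewrite lte_fin; lra.
  apply/mk_leP => x Lx; have /bridge_lip1[La Lb _] := Lx.
  rewrite PhiE PsiE; apply: le_trans (split_diff _ _ _ _ _ _ t01) _.
  apply: lerD; last apply: lerD.
  + by apply: h1 closeA _ La => //; exact: lt_le_trans tt' dd1.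
  + apply: h2 closeB _ Lb => //.
    rewrite (_ : 1 - t - (1 - t') = t' - t); last by ring.
    by rewrite distrC; exact: lt_le_trans tt' dd2.
  + have d3E : d3 * (`|K| + 1) = e / 4 by rewrite divfK // lt0r_neq0.
    rewrite -d3E; apply: ler_pM; rewrite ?cabs_ge0 ?normr_ge0 //.
      exact: le_trans (ltW tt') dd3.
    have := hK _ _ sphi' spsi' _ Lx; have := ler_norm K; lra.
- apply: (mk_weak_star_continuous cS).
  + exact: bridge_lipnorm_finite_sa.
  + exact: bridge_lipnorm_ge0.
  + exact: bridge_lipnormZ.
  + exact: bridge_lipnorm_dense.
Qed.

Lemma bridge_is_qcms : is_qcms (sum_star sA sB) (sum_norm nA nB) L.
Proof.
split.
- exact: bridge_lipnorm_finite_sa.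
- split; [exact: bridge_lipnorm_ge0|split].
    exact: bridge_lipnormZ.
  exact: bridge_lipnormD.
- exact: bridge_lipnorm_dense.
- exact: bridge_lipnorm_ker.
- exact: bridge_mk_metrizes.
Qed.

(** * Leibniz inequalities, admissibility and the Hausdorff estimate *)

Lemma bridge_lipnorm_leibniz : leibniz_ineq (sum_star sA sB) (sum_norm nA nB) L.
Proof.
(* Here [z] will be the sum or difference of the gaps of [x * y] and [y * x]; both gaps have the
   same bound, and the coefficient of modulus [1/2] averages them. *)
have gap_half (c : R[i]) x y z : cabs c = 2^-1 ->
    sa (sum_star sA sB) x -> sa (sum_star sA sB) y ->
    nD z <= nD (bridge_gap (x * y)) + nD (bridge_gap (y * x)) ->
    (((lam + eps)^-1 * nD (c *: z))%:E <=
      (sum_norm nA nB x)%:E * L y + (sum_norm nA nB y)%:E * L x)%E.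
  move=> c2 sx sy hz.
  have nx := nrm_ge0 cS x; have ny := nrm_ge0 cS y.
  have [_ _ gx] := bridge_lipnorm_bounds x; have [_ _ gy] := bridge_lipnorm_bounds y.
  apply: le_trans (leeD (lee_wpmul2l _ gy) (lee_wpmul2l _ gx)); rewrite ?lee_fin //.
  rewrite (nrmZ cD) c2.
  have := nrm_bridge_gapM sx sy; have := nrm_bridge_gapM sy sx => h1 h2.
  rewrite !mulrA ![_ * (lam + eps)^-1]mulrC -!mulrA -mulrDr.
  by rewrite ler_pM2l ?invr_gt0 //; lra.
move=> x y sx sy.
case: (x) (y) sx sy => [a b] [a' b'] sx sy; case: (sx) (sy) => saa sab [saa' sab'].
have [ax bx _] := bridge_lipnorm_bounds (a, b).
have [ay by' _] := bridge_lipnorm_bounds (a', b').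
have na : nA a <= sum_norm nA nB (a, b) by rewrite /sum_norm le_max lexx.
have nb : nB b <= sum_norm nA nB (a, b) by rewrite /sum_norm le_max lexx orbT.
have na' : nA a' <= sum_norm nA nB (a', b') by rewrite /sum_norm le_max lexx.
have nb' : nB b' <= sum_norm nA nB (a', b') by rewrite /sum_norm le_max lexx orbT.
case: (qA) => _ [LA0 _] _ _ _; case: (qB) => _ [LB0 _] _ _ _.
case: lA => _ _ /(_ a a' saa saa')[jA liA]; case: lB => _ _ /(_ b b' sab sab')[jB liB].
have boundA : ((nA a)%:E * LA a' + (nA a')%:E * LA a <=
    (sum_norm nA nB (a, b))%:E * L (a', b') + (sum_norm nA nB (a', b'))%:E * L (a, b))%E.
  by apply: leeD; apply: lee_pmul; rewrite ?lee_fin ?(nrm_ge0 cA) ?LA0.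
have boundB : ((nB b)%:E * LB b' + (nB b')%:E * LB b <=
    (sum_norm nA nB (a, b))%:E * L (a', b') + (sum_norm nA nB (a', b'))%:E * L (a, b))%E.
  by apply: leeD; apply: lee_pmul; rewrite ?lee_fin ?(nrm_ge0 cB) ?LB0.
split; rewrite bridge_lipnorm_le; apply/and3P; split.
- exact: le_trans jA boundA.
- exact: le_trans jB boundB.
- rewrite bridge_gapZ; apply: gap_half => //; first exact: cabs_half.
  by rewrite bridge_gapD (nrmD cD).
- exact: le_trans liA boundA.
- exact: le_trans liB boundB.
- rewrite bridge_gapZ; apply: gap_half => //.
    by rewrite invfM cabsM cabs_half /cabs Normc.normcV -/(cabs _) cabs_iC invr1 mulr1.
  by rewrite bridge_gapB (nrmB cD).
Qed.

(* Rescaling to the unit ball: the reach provides a partner for [a / m]. *)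
Lemma bridge_lipnorm_extend_left a (m d : R) : sa sA a -> 0 < m ->
  (LA a <= m%:E)%E -> 0 < d ->
  exists2 b, sa sB b & (L (a, b) <= (m * (1 + d))%:E)%E.
Proof.
move=> saa m0 Lam d0; case: (qA) => _ [_ [LAZ _]] _ _ _.
(* The reach gives a gap below [lam + d * (lam + eps)], which is at most [(1 + d) * (lam + eps)]
   because [0 <= eps]. *)
have e0 : 0 < d * (lam + eps) by rewrite mulr_gt0.
have La := lip1_rescale cA LAZ m0 saa Lam.
have [b [sab Lb] gap] := reach_left La e0.
exists (rC m *: b); first exact: (sa_rCZ cB).
have -> : (a, rC m *: b) = rC m *: (rC m^-1 *: a, b) :> (A * B)%type.
  by rewrite -[RHS]/(_ *: _, _ *: _) scalerA rCVK ?lt0r_neq0 // scale1r.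
rewrite bridge_lipnormZ gtr0_norm // EFinM lee_pmul2l //.
case: La => _ La; rewrite bridge_lipnorm_le; apply/and3P; split.
- by apply: le_trans La _; rewrite lee_fin; lra.
- by apply: le_trans Lb _; rewrite lee_fin; lra.
- by rewrite lee_fin mulrC ler_pdivrMr //; move: eps0 gap; lra.
Qed.

Lemma bridge_lipnorm_extend_right b (m d : R) : sa sB b -> 0 < m ->
  (LB b <= m%:E)%E -> 0 < d ->
  exists2 a, sa sA a & (L (a, b) <= (m * (1 + d))%:E)%E.
Proof.
move=> sab m0 Lbm d0; case: (qB) => _ [_ [LBZ _]] _ _ _.
have e0 : 0 < d * (lam + eps) by rewrite mulr_gt0.
have Lb := lip1_rescale cB LBZ m0 sab Lbm.
have [a [saa La] gap] := reach_right Lb e0.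
exists (rC m *: a); first exact: (sa_rCZ cA).
have -> : (rC m *: a, b) = rC m *: (a, rC m^-1 *: b) :> (A * B)%type.
  by rewrite -[RHS]/(_ *: _, _ *: _) scalerA rCVK ?lt0r_neq0 // scale1r.
rewrite bridge_lipnormZ gtr0_norm // EFinM lee_pmul2l //.
case: Lb => _ Lb; rewrite bridge_lipnorm_le; apply/and3P; split.
- by apply: le_trans La _; rewrite lee_fin; lra.
- by apply: le_trans Lb _; rewrite lee_fin; lra.
- by rewrite lee_fin mulrC ler_pdivrMr //; move: eps0 gap; lra.
Qed.

(** [L] dominates [LA] and [LB], and the extension lemmas approach them up to a factor [1 + d]. *)
Lemma bridge_admissible : admissible sA sB nA nB LA LB L.
Proof.
split; first exact: bridge_is_qcms.
- move=> a saa; apply: ereal_inf_approx; first by case: qA => _ [].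
    by move=> _ [b _ <-]; case: (bridge_lipnorm_bounds (a, b)).
  move=> r d r0 Lr d0; have [b sab h] := bridge_lipnorm_extend_left saa r0 Lr d0.
  by exists (L (a, b)) => //; exists b.
- move=> b sab; apply: ereal_inf_approx; first by case: qB => _ [].
    by move=> _ [a _ <-]; case: (bridge_lipnorm_bounds (a, b)).
  move=> r d r0 Lr d0; have [a saa h] := bridge_lipnorm_extend_right sab r0 Lr d0.
  by exists (L (a, b)) => //; exists a.
Qed.

(** A state of one summand reaches some [theta] of the 1-level at cost [lam + e] by the height, and
    crossing to the other summand along [theta] costs at most [lam + eps]. *)
Lemma bridge_haus_le : (haus (mk (sum_star sA sB) L)
  (@stA _ _ B @` states sA) (@stB _ A _ @` states sB) <= (2 * lam + eps)%:E)%E.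
Proof.
apply: haus_le => _ e [phi sphi <-] e0.
  have [theta lt h] := height_left sphi e0.
  exists (stB (theta \o piB)).
    by exists (theta \o piB) => //; exact: (is_state_comp mB (level1_state lt)).
  apply/mk_leP => x /bridge_lip1[La _ gap]; rewrite /stA /stB /=.
  apply: le_trans (cabs_dist_trans (theta (piA x.1)) _ _) _.
  have := mk_lt h La; have := level1_gap x lt; rewrite /=; lra.
have [theta lt h] := height_right sphi e0.
exists (stA (theta \o piA)).
  by exists (theta \o piA) => //; exact: (is_state_comp mA (level1_state lt)).
apply/mk_leP => x /bridge_lip1[_ Lb gap]; rewrite /stA /stB /=.
apply: le_trans (cabs_dist_trans (theta (piB x.2)) _ _) _.
by have := mk_lt h Lb; rewrite cabs_distC; have := level1_gap x lt; rewrite /=; lra.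
Qed.

End BridgeLipNorm.

Theorem mainTheorem14 (R : realType) (A B D : algType R[i])
  (sA : A -> A) (nA : A -> R) (sB : B -> B) (nB : B -> R)
  (sD : D -> D) (nD : D -> R)
  (LA : A -> \bar R) (LB : B -> \bar R)
  (omega : D) (piA : A -> D) (piB : B -> D) (lam eps : R) :
  is_cstar sA nA -> is_cstar sB nB -> is_cstar sD nD ->
  is_leibniz_qcms sA nA LA -> is_leibniz_qcms sB nB LB ->
  is_bridge sA sB sD omega piA piB ->
  bridge_length sA sB sD nD LA LB omega piA piB = lam%:E ->
  0 <= eps -> 0 < lam + eps ->
  let Leps := bridge_lipnorm nD LA LB omega piA piB lam eps in
  [/\ is_qcms (sum_star sA sB) (sum_norm nA nB) Leps,
      admissible sA sB nA nB LA LB Leps,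
      leibniz_ineq (sum_star sA sB) (sum_norm nA nB) Leps,
      (haus (mk (sum_star sA sB) Leps)
         (@stA _ _ B @` states sA) (@stB _ A _ @` states sB) <= (2 * lam + eps)%:E)%E &
      (dist_q sA sB nA nB LA LB <= (2 * lam)%:E)%E].
Proof.
move=> cA cB cD lA lB br lenE eps0 le0 /=; split.
- exact: (bridge_is_qcms cA cB cD lA lB br le0).
- exact: (bridge_admissible cA cB cD lA lB br lenE eps0 le0).
- exact: (bridge_lipnorm_leibniz cA cB cD lA lB br le0).
- exact: (bridge_haus_le cD br lenE le0).
(* Any [e > 0] may take the place of [eps], even when [lam = 0]; the infimum is then at most
   [2 * lam + e]. *)
apply/lee_addgt0Pr => e e0.
have lam0 := bridge_length_ge0 cA cD lA lenE.
have le : 0 < lam + e by rewrite ltr_wpDl.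
apply: ge_ereal_inf; eexists; last exact: (bridge_haus_le cD br lenE le).
exists (bridge_lipnorm nD LA LB omega piA piB lam e) => //.
exact: (bridge_admissible cA cB cD lA lB br lenE (ltW e0) le).
Qed.
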